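(* Let $W$ be a finite Weyl group with real reflection representation $E$ of dimension $l$, and let $[\pi]\in\overline R(W)$. Let $\widetilde\sigma_\pi^+,\widetilde\sigma_\pi^-$ be the $\widetilde W'$-representations attached to $[\pi]$, characterized by $\pi\otimes(S^+-S^-)=\widetilde\sigma_\pi^+-\widetilde\sigma_\pi^-$ with $\widetilde\sigma_\pi^+$ and $\widetilde\sigma_\pi^-$ orthogonal. Then the elliptic fake degree of $[\pi]$ equals $$F_{[\pi]}=\frac12\,(q-1)^l\,\big\langle \widetilde\sigma_\pi^+-\widetilde\sigma_\pi^-,\;S_qE\otimes(S^+-S^-)\big\rangle_{\widetilde W'} .$$
   Context: $R(W)$ is the Grothendieck group of finite-dimensional complex $W$-representations. The elliptic pairing is $\langle\sigma,\sigma'\rangle^{\mathrm{ell}}_W=\frac1{|W|}\sum_{w\in W}\sigma(w)\sigma'(w)\det_E(1-w)$, and $\overline R(W)=R(W)/\mathrm{rad}\langle\,,\,\rangle^{\mathrm{ell}}_W$. $S_qE=\sum_{i\ge0}q^iS^iE$ is the graded symmetric algebra, with $W$-character $w\mapsto 1/\det_E(1-qw)$; pairings with $S_qE$ are taken coefficientwise in $q$. The elliptic fake degree is $F_{[\pi]}=(q-1)^l\langle\pi,S_qE\rangle^{\mathrm{ell}}_W=\frac{(q-1)^l}{|W|}\sum_{w\in W}\pi(w)\frac{\det(1-w)}{\det(1-qw)}\in\mathbb Q(q)$. Fix a $W$-invariant inner product on $E$. $C(E)$ is the Clifford algebra generated by $E$ with relations $\xi\xi'+\xi'\xi=-2(\xi,\xi')$;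 it is $\mathbb Z/2$-graded, $C(E)=C(E)_{\mathrm{even}}+C(E)_{\mathrm{odd}}$. Let ${}^t$ be the anti-automorphism with $\xi^t=-\xi$ for $\xi\in E$, and $\epsilon$ the automorphism equal to $+1$ on the even part and $-1$ on the odd part. $\mathrm{Pin}(E)=\{a\in C(E)^\times:\epsilon(a)Ea^{-1}\subset E,\ a^t=a^{-1}\}$, and $p:\mathrm{Pin}(E)\to O(E)$, $p(a)(\xi)=\epsilon(a)\xi a^{-1}$, is a two-fold cover. $\widetilde W=p^{-1}(W)$; $\widetilde W'=\widetilde W$ if $l$ is odd and $\widetilde W'=\widetilde W\cap C(E)_{\mathrm{even}}$ if $l$ is even. $S^\pm$ are the two basic spin modules restricted to $\widetilde W'$: for $l$ odd, the restrictions of the two inequivalent simple complex $C(E)$-modules; for $l$ even, the restrictions of the two simple $C(E)_{\mathrm{even}}$-constituents of the unique simple complex $C(E)$-module. $\langle\,,\,\rangle_{\widetilde W'}$ is the usual character pairing. It is known (Ciubotaru–Opdam–Trapa) that the map $\iota:\overline R(W)\to R(\widetilde W')$, $\sigma\mapsto\sigma\otimes(S^+-S^-)$, is well defined and injective, that $2\langle\sigma,\sigma'\rangle^{\mathrm{ell}}_W=\langle\iota(\sigma),\iota(\sigma')\rangle_{\widetilde W'}$, and that for each $[\pi]\in\overline R(W)$ there are unique orthogonal (i.e. having no common irreducible constituent) $\widetilde W'$-representations $\widetilde\sigma_\pi^\pm$ with $\iota([\pi])=\widetilde\sigma_\pi^+-\widetilde\sigma_\pi^-$. *)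

(* Defs.v *)
From HB Require Import structures.
From mathcomp Require Import all_boot all_order all_algebra all_fingroup.
From mathcomp Require Import mxrepresentation character.
From mathcomp Require Import reals complex mpoly.

Set Implicit Arguments.
Unset Strict Implicit.
Unset Printing Implicit Defensive.

Import Order.TTheory GRing.Theory Num.Theory GroupScope.
Local Open Scope ring_scope.

(* Throughout, E = 'cV[R]_l and matrices act on column vectors from the left,  *)
(* so that w |-> rE w and the map p of the Pin group are left actions.         *)

Record root_system (R : realType) (l : nat) := RootSystem {
  roots : seq 'cV[R]_l;
  coroot : 'cV[R]_l -> 'rV[R]_l;
  roots_span : <<roots>>%VS = fullv;
  roots_neq0 : 0 \notin roots;
  corootK : {in roots, forall a, coroot a *m a = 2%:M};
  roots_refl : {in roots &, forall a b, b - a *m (coroot a *m b) \in roots};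
  roots_int : {in roots &, forall a b, (coroot a *m b) 0 0 \is a Num.int}
}.

Definition reflection (R : realType) (l : nat) (Phi : root_system R l)
    (a : 'cV[R]_l) : 'M[R]_l :=
  1%:M - a *m coroot Phi a.

(* rE identifies W with the subgroup of GL(E) generated by the reflections    *)
(* s_a, for a in Phi.                                                         *)
Definition is_weyl_group (R : realType) (l : nat) (Phi : root_system R l)
    (gT : finGroupType) (W : {group gT}) (rE : mx_representation R W l) : Prop :=
  [/\ mx_faithful rE,
      {in roots Phi, forall a, exists2 w, w \in W & rE w = reflection Phi a}
    & W :=: <<[set w in W | has (fun a => rE w == reflection Phi a)
                                (roots Phi)]>> ].

Definition form (R : realType) (l : nat) (B : 'M[R]_l) (x y : 'cV[R]_l) : R :=
  (x^T *m B *m y) 0 0.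

Definition invariant_inner_product (R : realType) (l : nat) (gT : finGroupType)
    (W : {group gT}) (rE : mx_representation R W l) (B : 'M[R]_l) : Prop :=
  [/\ forall x y, form B x y = form B y x,
      forall x, x != 0 -> 0 < form B x x
    & {in W, forall w x y, form B (rE w *m x) (rE w *m y) = form B x y}].

Definition clifford_rel (R : realType) (l : nat) (B : 'M[R]_l) (A : algType R)
    (f : 'cV[R]_l -> A) : Prop :=
  forall x y, f x * f y + f y * f x = (- (2 * form B x y))%:A.

(* C(E), presented by generators E and relations clifford_rel, is given by    *)
(* its universal property.                                                    *)
Record clifford (R : realType) (l : nat) (B : 'M[R]_l) := Clifford {
  cl_alg :> algType R;
  cl_gen : {linear 'cV[R]_l -> cl_alg};
  cl_genP : clifford_rel B cl_gen;
  cl_lift : forall (A : algType R) (f : {linear 'cV[R]_l -> A}),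
    clifford_rel B f ->
    exists g : {lrmorphism cl_alg -> A}, forall x, g (cl_gen x) = f x;
  cl_lift_uniq : forall (A : algType R) (g h : {lrmorphism cl_alg -> A}),
    (forall x, g (cl_gen x) = h (cl_gen x)) -> g =1 h
}.

(* cl_graded false = C(E)_even and cl_graded true = C(E)_odd, the spans of the *)
(* products of an even, resp. odd, number of vectors.                          *)
Inductive cl_graded (R : realType) (l : nat) (B : 'M[R]_l) (Cl : clifford B) :
    bool -> Cl -> Prop :=
| ClScalar k : cl_graded false (k%:A)
| ClGen b x a : cl_graded b a -> cl_graded (~~ b) (cl_gen Cl x * a)
| ClAdd b a a' : cl_graded b a -> cl_graded b a' -> cl_graded b (a + a')
| ClZero b : cl_graded b 0.

Definition is_grading_aut (R : realType) (l : nat) (B : 'M[R]_l)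
    (Cl : clifford B) (eps : {lrmorphism Cl -> Cl}) : Prop :=
  forall b (a : Cl), cl_graded b a -> eps a = (-1) ^+ b * a.

Definition is_transpose (R : realType) (l : nat) (B : 'M[R]_l)
    (Cl : clifford B) (tr : {linear Cl -> Cl}) : Prop :=
  [/\ tr 1 = 1, forall a b, tr (a * b) = tr b * tr a
    & forall x, tr (cl_gen Cl x) = - cl_gen Cl x].

Section Pin.

Variables (R : realType) (l : nat) (B : 'M[R]_l) (Cl : clifford B).
Variables (eps : {lrmorphism Cl -> Cl}) (tr : {linear Cl -> Cl}).

(* The first two conditions say that a is invertible with inverse a^t. *)
Definition in_pin (a : Cl) : Prop :=
  [/\ a * tr a = 1, tr a * a = 1
    & forall x, exists y, eps a * cl_gen Cl x * tr a = cl_gen Cl y].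

(* p(a) = g; here a^-1 = a^t since a is in Pin(E). *)
Definition pin_acts (a : Cl) (g : 'M[R]_l) : Prop :=
  forall x, eps a * cl_gen Cl x * tr a = cl_gen Cl (g *m x).

Variables (gT : finGroupType) (W : {group gT}) (rE : mx_representation R W l).

Definition in_Wtilde (a : Cl) : Prop :=
  in_pin a /\ exists2 w, w \in W & pin_acts a (rE w).

Definition in_Wtilde' (a : Cl) : Prop :=
  in_Wtilde a /\ (~~ odd l -> cl_graded false a).

(* The subgroup W~' of C(E)^x, as a finite group pc_grp with an isomorphism   *)
(* pc_emb onto it; pc_proj is the covering map p.                             *)
Record pin_cover := PinCover {
  pc_gT : finGroupType;
  pc_grp : {group pc_gT};
  pc_emb : pc_gT -> Cl;
  pc_embM : {in pc_grp &, {morph pc_emb : g h / (g * h)%g >-> g * h}};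
  pc_emb_inj : {in pc_grp &, injective pc_emb};
  pc_embP : forall a, (exists2 g, g \in pc_grp & pc_emb g = a) <-> in_Wtilde' a;
  pc_proj : {morphism pc_grp >-> gT};
  pc_projW : {in pc_grp, forall g, pc_proj g \in W};
  pc_projP : {in pc_grp, forall g, pin_acts (pc_emb g) (rE (pc_proj g))}
}.

End Pin.

Section Grothendieck.

Variables (C : fieldType) (gT : finGroupType) (G : {group gT}).
Local Notation rep := (representation C G).

Lemma tensor_mx_repr (U V : rep) : mx_repr G (fun g => tprod (U g) (V g)).
Proof.
split=> [|g h Gg Gh]; first by rewrite !repr_mx1 tprod1.
by rewrite !repr_mxM // tprodE.
Qed.
Definition tensor_rep (U V : rep) : rep :=
  Representation (MxRepresentation (tensor_mx_repr U V)).

(* (U, V) stands for the formal difference [U] - [V]; veq is equality in R(G). *)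
Definition vrep : Type := (rep * rep)%type.

Definition vrep_of (U : rep) : vrep := (U, @grepr0 C gT G).
Definition vsub (V V' : vrep) : vrep :=
  (dadd_grepr V.1 V'.2, dadd_grepr V.2 V'.1).
Definition vtensor (V V' : vrep) : vrep :=
  (dadd_grepr (tensor_rep V.1 V'.1) (tensor_rep V.2 V'.2),
   dadd_grepr (tensor_rep V.1 V'.2) (tensor_rep V.2 V'.1)).

Definition veq (V V' : vrep) : Prop :=
  exists U : rep, mx_rsim (dadd_grepr (dadd_grepr V.1 V'.2) U)
                          (dadd_grepr (dadd_grepr V'.1 V.2) U).

Definition vchar (V : vrep) (g : gT) : C := \tr (V.1 g) - \tr (V.2 g).

Definition constituent (T U : rep) : Prop :=
  exists2 f : 'M[C]_(rdegree U, rdegree T), \rank f = rdegree T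
    & {in G, forall g, U g *m f = f *m T g}.

Definition no_common_constituent (U V : rep) : Prop :=
  forall T : rep, mx_irreducible T -> constituent T U -> ~ constituent T V.

End Grothendieck.

Lemma pull_mx_repr (C : fieldType) (gT hT : finGroupType) (G : {group gT})
    (H : {group hT}) (f : {morphism H >-> gT}) (fG : {in H, forall h, f h \in G})
    (U : representation C G) :
  mx_repr H (fun h => U (f h)).
Proof.
split=> [|g h Hg Hh]; first by rewrite morph1 repr_mx1.
by rewrite morphM // repr_mxM ?fG.
Qed.
Definition pull_rep (C : fieldType) (gT hT : finGroupType) (G : {group gT})
    (H : {group hT}) (f : {morphism H >-> gT}) (fG : {in H, forall h, f h \in G})
    (U : representation C G) : representation C H :=
  Representation (MxRepresentation (pull_mx_repr fG U)).
Definition pull_vrep (C : fieldType) (gT hT : finGroupType) (G : {group gT})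
    (H : {group hT}) (f : {morphism H >-> gT}) (fG : {in H, forall h, f h \in G})
    (V : vrep C G) : vrep C H :=
  (pull_rep fG V.1, pull_rep fG V.2).

Definition char_pairing (R : realType) (gT : finGroupType) (G : {group gT})
    (V V' : vrep R[i] G) : R[i] :=
  #|G|%:R^-1 * \sum_(g in G) vchar V g * (vchar V' g)^*%C.

Definition ell_pairing (R : realType) (l : nat) (gT : finGroupType)
    (W : {group gT}) (rE : mx_representation R W l) (V V' : vrep R[i] W) : R[i] :=
  #|W|%:R^-1 *
    \sum_(w in W) vchar V w * vchar V' w * (\det (1%:M - rE w))%:C%C.

(* V and V' have the same class in R(W) / rad < , >^ell. *)
Definition ell_eq (R : realType) (l : nat) (gT : finGroupType)
    (W : {group gT}) (rE : mx_representation R W l) (V V' : vrep R[i] W) : Prop :=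
  forall U : vrep R[i] W, ell_pairing rE (vsub V V') U = 0.

Section SymmetricPower.

Variables (F : fieldType) (l : nat).

Definition hmonom (d : nat) := [pred m : 'X_{1..l < d.+1} | mdeg m == d].

(* The substitution 'X_j := \sum_k M k j 'X_k, i.e. the algebra endomorphism of *)
(* F['X_1, .., 'X_l] = S(E) extending M, with 'X_j the j-th basis vector of E.  *)
Definition lin_subst (M : 'M[F]_l) (p : {mpoly F[l]}) : {mpoly F[l]} :=
  p \mPo [tuple \sum_k M k j *: 'X_k | j < l].

(* The matrix of S^d M in the basis of monomials of degree d. *)
Definition sym_mx (d : nat) (M : 'M[F]_l) : 'M[F]_#|hmonom d| :=
  \matrix_(i, j) (lin_subst M 'X_[bmnm (enum_val j)])@_(bmnm (enum_val i)).

Lemma lin_substX M m :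
  lin_subst M 'X_[m] = \prod_(j < l) (\sum_k M k j *: 'X_k) ^+ m j.
Proof.
by rewrite /lin_subst comp_mpolyX; apply: eq_bigr => j _; rewrite tnth_mktuple.
Qed.

Lemma lin_subst_homog M m : lin_subst M 'X_[m] \is (mdeg m).-homog.
Proof.
rewrite lin_substX mdegE.
apply: (big_ind2 (fun (p : {mpoly F[l]}) d => p \is d.-homog)) => //.
- exact: dhomog1.
- by move=> p d q e; apply: dhomogM.
move=> j _; rewrite -[X in X.-homog]mul1n; apply: dhomogMn.
by apply: rpred_sum => k _; apply: dhomogZ; rewrite dhomogX; apply/eqP; exact: mdeg1.
Qed.

Lemma homog_expand d (p : {mpoly F[l]}) : p \is d.-homog ->
  p = \sum_(i < #|hmonom d|) p@_(bmnm (enum_val i)) *: 'X_[bmnm (enum_val i)].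
Proof.
move=> hp; apply/mpolyP => m; rewrite linear_sum /=.
have [dm|dm] := eqVneq (mdeg m) d; last first.
  rewrite (dhomog_nemf_coeff hp dm) big1 // => i _.
  rewrite linearZ /= mcoeffX; case: eqP => [e|_]; last by rewrite mulr0.
  by case/negP: dm; rewrite -e; have := enum_valP i.
have lt_m : (mdeg m < d.+1)%N by rewrite dm.
have hm : BMultinom lt_m \in hmonom d by rewrite unfold_in /= dm.
rewrite (bigD1 (enum_rank_in hm (BMultinom lt_m))) //=.
rewrite linearZ /= enum_rankK_in // mcoeffX eqxx mulr1 big1 ?addr0 // => i ne.
rewrite linearZ /= mcoeffX; case: eqP => [e|_]; last by rewrite mulr0.
case/negP: ne; apply/eqP/enum_val_inj; rewrite enum_rankK_in //.
exact: val_inj.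
Qed.

Lemma lin_subst_sum M I r (a : I -> F) (p : I -> {mpoly F[l]}) :
  lin_subst M (\sum_(i <- r) a i *: p i) =
  \sum_(i <- r) a i *: lin_subst M (p i).
Proof. by rewrite /lin_subst linear_sum; apply: eq_bigr => i _; rewrite linearZ. Qed.

Lemma lin_substM M N p : lin_subst (M *m N) p = lin_subst M (lin_subst N p).
Proof.
rewrite (mpolyE p) !lin_subst_sum; apply: eq_bigr => m _; congr (_ *: _).
rewrite !lin_substX.
rewrite /lin_subst rmorph_prod; apply: eq_bigr => j _; rewrite rmorphXn.
congr (_ ^+ _).
transitivity (\sum_k \sum_r (M k r * N r j) *: ('X_k : {mpoly F[l]})).
  by apply: eq_bigr => k _; rewrite mxE scaler_suml.
rewrite exchange_big rmorph_sum; apply: eq_bigr => r _ /=.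
rewrite linearZ /= comp_mpolyXU -tnth_nth tnth_mktuple scaler_sumr.
by apply: eq_bigr => k _; rewrite scalerA mulrC.
Qed.

Lemma lin_subst1 p : lin_subst 1%:M p = p.
Proof.
rewrite -[RHS]comp_mpoly_id /lin_subst; congr (_ \mPo _).
apply: eq_from_tnth => j; rewrite !tnth_mktuple (bigD1 j) //= mxE eqxx scale1r.
by rewrite big1 ?addr0 // => k kj; rewrite mxE (negPf kj) scale0r.
Qed.

Lemma sym_mx1 d : sym_mx d 1%:M = 1%:M.
Proof.
apply/matrixP => i j; rewrite !mxE lin_subst1 mcoeffX; congr (_%:R).
by rewrite (inj_eq val_inj) (inj_eq enum_val_inj) eq_sym.
Qed.

Lemma sym_mxM d M N : sym_mx d (M *m N) = sym_mx d M *m sym_mx d N.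
Proof.
apply/matrixP => i j; rewrite !mxE lin_substM.
have hN := lin_subst_homog N (bmnm (enum_val j)).
rewrite (eqP (enum_valP j : mdeg (enum_val j) == d)) in hN.
rewrite {1}(homog_expand hN) lin_subst_sum linear_sum /=.
by apply: eq_bigr => k _; rewrite linearZ /= !mxE mulrC.
Qed.

End SymmetricPower.

Section SymRep.

Variables (R : realType) (l : nat) (gT : finGroupType) (W : {group gT}).
Variable (rE : mx_representation R W l).

Lemma sym_mx_repr d :
  mx_repr W (fun w => sym_mx d (map_repr (real_complex R) rE w)).
Proof.
split=> [|g h Wg Wh]; first by rewrite repr_mx1 sym_mx1.
by rewrite repr_mxM // sym_mxM.
Qed.

(* The complexification of S^d E. *)
Definition sym_rep (d : nat) : representation R[i] W :=
  Representation (MxRepresentation (sym_mx_repr d)).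

End SymRep.

Definition qcst (C : fieldType) (c : C) : {fraction {poly C}} := tofrac c%:P.
Definition qvar (C : fieldType) : {fraction {poly C}} := tofrac 'X.

(* An element of C(q), with q = qvar. *)
Definition fake_degree (R : realType) (l : nat) (gT : finGroupType)
    (W : {group gT}) (rE : mx_representation R W l) (V : vrep R[i] W) :
    {fraction {poly R[i]}} :=
  (qvar _ - 1) ^+ l / #|W|%:R *
    \sum_(w in W) qcst (vchar V w) * qcst (\det (1%:M - rE w))%:C%C /
      \det (1%:M - qvar _ *: map_mx (fun x : R => qcst x%:C%C) (rE w)).

(* f is regular at q = 0, with power series expansion \sum_n (s n) q^n. *)
Definition has_expansion (C : fieldType) (f : {fraction {poly C}})
    (s : nat -> C) : Prop :=
  exists N D : {poly C}, [/\ D`_0 != 0, f = tofrac N / tofrac D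
    & forall n, N`_n = \sum_(k < n.+1) D`_k * s (n - k)%N].

Section SpinModules.

Variables (R : realType) (l : nat) (B : 'M[R]_l) (Cl : clifford B).

Definition cmodule (n : nat) : Type :=
  {lrmorphism Cl -> 'M[R[i]]_n | real_complex R \; *:%R}.

(* The module C^n (column vectors) has no proper nonzero complex subspace      *)
(* stable under the f a with a in D; a subspace is given by the row space of U, *)
(* whence the transpose.                                                       *)
Definition simple_on (D : Cl -> Prop) (n : nat) (f : Cl -> 'M[R[i]]_n) : Prop :=
  (0 < n)%N /\ forall U : 'M[R[i]]_n,
    (forall a, D a -> stablemx U (f a)^T) -> U = 0 \/ row_full U.

Definition cmodule_iso (n m : nat) (f : cmodule n) (g : cmodule m) : Prop :=
  exists P : 'M[R[i]]_(n, m), [/\ row_free P, row_full P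
    & forall a, f a *m P = P *m g a].

Variables (gT : finGroupType) (G : {group gT}) (emb : gT -> Cl).
Variables Sp Sm : representation R[i] G.

Definition spin_pair_odd : Prop :=
  exists (fp : cmodule (rdegree Sp)) (fm : cmodule (rdegree Sm)),
    [/\ simple_on (fun=> True) fp, simple_on (fun=> True) fm,
        ~ cmodule_iso fp fm,
        {in G, forall g, Sp g = fp (emb g)}
      & {in G, forall g, Sm g = fm (emb g)}].

(* f is a simple C(E)-module which, restricted to C(E)_even, is isomorphic to *)
(* the direct sum of fp and fm, via P.                                        *)
Definition spin_pair_even : Prop :=
  exists (f : cmodule (rdegree Sp + rdegree Sm))
         (fp : Cl -> 'M[R[i]]_(rdegree Sp)) (fm : Cl -> 'M[R[i]]_(rdegree Sm))
         (P : 'M[R[i]]_(rdegree Sp + rdegree Sm)),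
    [/\ simple_on (fun=> True) f,
        P \in unitmx /\ (forall a : Cl, cl_graded false a ->
          f a *m P = P *m block_mx (fp a) 0 0 (fm a)),
        simple_on (@cl_graded _ _ _ Cl false) fp /\
        simple_on (@cl_graded _ _ _ Cl false) fm,
        {in G, forall g, Sp g = fp (emb g)}
      & {in G, forall g, Sm g = fm (emb g)}].

Definition spin_pair : Prop := if odd l then spin_pair_odd else spin_pair_even.

End SpinModules.

(* Main.v *)
(* The heart of the matter is the identity |S^+ - S^-|^2(g) = c det_E(1 - p(g))
   for g in W~', with c = 1 if l is even and c = 2 if l is odd.

   Suppose that anticommuting square roots of -1 act on C^n with scalar
   commutant and that some involution anticommutes with all of them. Averaging
   over their products shows that these products form a basis of the n x n
   matrices. If conjugation by A maps the span of these roots to itself with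
   eigenvalues mu_j, then it is diagonal in the basis of ordered products of
   eigenvectors, with trace (tr A)(tr A^-1) = prod_j (1 + mu_j). For l even take
   A = g omega, with omega = 1 on S^+ and -1 on S^-: conjugation by A is -p(g)
   on E. For l odd, S^- is S^+ twisted by the grading automorphism; doubling the
   module reduces to dimension l + 1.

   The image of W~' in W is W if l is odd. If l is even it has index 2, and
   det(1 - w) = 0 for w outside the image, by the same trace formula. Hence
   summing over W~' doubles the elliptic pairing of W, coefficientwise in q, and
   Molien's formula identifies the series with the elliptic fake degree. *)

Require Import Defs.
From HB Require Import structures.
From mathcomp Require Import all_boot all_order all_algebra all_fingroup.
From mathcomp Require Import mxrepresentation character.
From mathcomp Require Import separable cyclotomic.
From mathcomp Require Import boolp reals complex mpoly.

Set Implicit Arguments.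
Unset Strict Implicit.
Unset Printing Implicit Defensive.

Import Order.TTheory GRing.Theory Num.Theory.
Local Open Scope ring_scope.

(** * Trace of a conjugation in a Clifford algebra *)

(** [C(E)] is given by a universal property and the spin modules only by simplicity, so dimensions
    and bases are extracted from one averaging operator, whose values are scalars by Schur's lemma.

    The anticommuting involution rules out the case where the product of all roots is a scalar and
    the products are linearly dependent. This happens for odd l, where the volume element acts by a
    scalar; the root added in the doubled module makes the number of generators even.

    Two families of generators are needed: a real orthonormal basis of E gives the anticommuting
    roots of -1 used for averaging, while the complex eigenvectors of p(g) diagonalize the
    conjugation but only satisfy that uv + vu is a scalar.

    The sign in -p(g) turns 1 + mu into 1 - d, whence det(1 - p(g)). The constant c = 2 for odd l
    comes from the added root: it commutes with A and contributes the factor 1 + 1. For a lift that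
    eps negates on the module, the doubled trace 2 tr A is exactly the difference of the two spin
    characters. *)

Section CliffordProducts.

Variables (C : numFieldType) (I : eqType) (n m : nat).
Variables (e : I -> 'M[C]_n) (e' : I -> 'M[C]_m).

Definition clifford_family (J : eqType) (k : nat) (u : J -> 'M[C]_k) : Prop :=
  (forall i j, i != j -> u i *m u j = - (u j *m u i)) /\
  (forall i, u i *m u i = - 1%:M).

(* The pairs (e_I, (e'_I)^-1), for e_I the ordered products of subfamilies. *)
Fixpoint cliff_prods (s : seq I) : seq ('M[C]_n * 'M[C]_m) :=
  if s is i :: r then
    cliff_prods r ++ [seq (e i *m p.1, - (p.2 *m e' i)) | p <- cliff_prods r]
  else [:: (1%:M, 1%:M)].

(** For duplicate-free [s] this is [2 ^ size s] times the projection onto the maps intertwining [e]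
    and [e']: a Reynolds operator indexed by ordered products. *)
Definition cliff_avg (s : seq I) (X : 'M[C]_(n, m)) : 'M[C]_(n, m) :=
  \sum_(p <- cliff_prods s) p.1 *m X *m p.2.

Lemma cliff_avg_cons i s X :
  cliff_avg (i :: s) X = cliff_avg s X - e i *m cliff_avg s X *m e' i.
Proof.
rewrite /cliff_avg /= big_cat big_map /=; congr (_ + _).
rewrite mulmx_sumr mulmx_suml -sumrN; apply: eq_bigr => p _ /=.
by rewrite mulmxN !mulmxA.
Qed.

Hypotheses (He : clifford_family e) (He' : clifford_family e').

(** Both squares are -1, so [Y - e i Y e' i] is intertwined by the new pair; the earlier pairs
    survive because passing [e i] and [e' i] costs two signs. *)
Lemma cliff_avg_intertwine s X : uniq s ->
  {in s, forall i, e i *m cliff_avg s X = cliff_avg s X *m e' i}.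
Proof.
case: He => ea e2; case: He' => ea' e2'.
elim: s => // j s IH /= /andP[js us] i; rewrite in_cons cliff_avg_cons.
set Y := cliff_avg s X in IH *.
case/predU1P => [->|si].
  rewrite mulmxBr mulmxBl !mulmxA e2 -!mulmxA e2' !mulmxN !mulNmx !mul1mx.
  by rewrite !mulmx1 !opprK addrC.
have ij : i != j by apply: contraNneq js => <-.
have iY := IH us i si; rewrite mulmxBr mulmxBl iY; congr (_ - _).
rewrite !mulmxA ea // !mulNmx -(mulmxA (e j) (e i)) iY -!mulmxA (ea' j i) ?mulmxN //.
by rewrite eq_sym.
Qed.

(** Both sides are the trace of the averaging operator on matrices; the right side evaluates it on
    elementary matrices. *)
Lemma trace_cliff_avg s :
  \sum_(p <- cliff_prods s) \tr p.1 * \tr p.2 =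
  \sum_a \sum_b cliff_avg s (delta_mx a b) a b.
Proof.
under [RHS]eq_bigr do under eq_bigr do rewrite /cliff_avg summxE.
under [RHS]eq_bigr do rewrite exchange_big.
rewrite [RHS]exchange_big /=; apply: eq_bigr => p _.
rewrite big_distrlr /=; apply: eq_bigr => a _; apply: eq_bigr => b _.
rewrite mxE (bigD1 b) //= mxE (bigD1 a) //= !mxE !eqxx mulr1 !big1 ?addr0 //.
  by move=> k /negPf kb; rewrite mxE big1 ?mul0r // => c _; rewrite !mxE kb andbF mulr0.
by move=> k /negPf kb; rewrite mxE kb mulr0.
Qed.

Variable w : 'M[C]_n.
Hypothesis (wunit : w \in unitmx).

(** The sign is the parity of the number of factors, which the list does not record. It is fixed
    before [x], so that one sign serves both a further generator and [w]. *)
Lemma cliff_prods_sign s : {in cliff_prods s, forall p, exists b : bool,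
  forall x, {in s, forall i, x *m e i = - (e i *m x)} ->
    x *m p.1 = (-1) ^+ b *: (p.1 *m x)}.
Proof.
elim: s => [|i s IH] p /=.
  rewrite inE => /eqP ->; exists false => x _.
  by rewrite /= expr0 scale1r mulmx1 mul1mx.
rewrite mem_cat => /orP[/IH[b hb]|/mapP[q /IH[b hb] ->]].
  by exists b => x hx; apply: hb => j js; apply: hx; rewrite in_cons js orbT.
exists (~~ b) => x hx /=; rewrite mulmxA hx ?mem_head // mulNmx -(mulmxA (e i) x) (hb x).
  by rewrite -scalemxAr !mulmxA -scaleNr; case: (b); rewrite /= ?expr0 ?expr1 ?opprK.
by move=> j js; apply: hx; rewrite in_cons js orbT.
Qed.

Lemma mxtrace_anticomm (x y : 'M[C]_n) :
  x \in unitmx -> x *m y = - (y *m x) -> \tr y = 0.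
Proof.
move=> ux xy; have : \tr y = - \tr y.
  rewrite -{1}(mulKmx ux y) xy mulmxN raddfN /= mulmxA mxtrace_mulC mulmxA.
  by rewrite mulmxV // mul1mx.
by move/eqP; rewrite -addr_eq0 -mulr2n mulrn_eq0 /= => /eqP.
Qed.

(** Only the empty product has nonzero trace: a nonempty product of even length changes sign when
    its first factor is moved cyclically to the end, and one of odd length anticommutes with the
    invertible [w]. *)
Lemma trace_cliff_prods s :
  {in s, forall i, w *m e i = - (e i *m w)} -> uniq s ->
  \sum_(p <- cliff_prods s) \tr p.1 * \tr p.2 = n%:R * m%:R.
Proof.
case: He => ea e2; elim: s => [|i s IH] we /=; first by rewrite big_seq1 !mxtrace1.
have we' : {in s, forall j, w *m e j = - (e j *m w)}.
  by move=> j js; apply: we; rewrite in_cons js orbT.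
case/andP => si us; rewrite big_cat /= IH // big_map big_seq big1 ?addr0 // => p ps.
suff -> : \tr (e i *m p.1) = 0 by rewrite mul0r.
have [b hb] := cliff_prods_sign ps.
have hi : {in s, forall j, e i *m e j = - (e j *m e i)}.
  by move=> j js; apply: ea; apply: contraNneq si => ->.
case: b hb => hb.
  apply/eqP; rewrite -[_ == 0](mulrn_eq0 _ 2) mulr2n {2}mxtrace_mulC.
  by rewrite (hb _ hi) /= expr1 scaleN1r raddfN /= addNr.
apply: (mxtrace_anticomm wunit).
rewrite mulmxA we ?mem_head // mulNmx -(mulmxA (e i) w) (hb w we').
by rewrite expr0 scale1r mulmxA.
Qed.

End CliffordProducts.

Lemma mxtrace_delta (R : pzRingType) (n : nat) (i j : 'I_n) :
  \tr (delta_mx i j : 'M[R]_n) = (i == j)%:R.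
Proof.
rewrite /mxtrace (bigD1 i) //= big1 => [|k /negPf ki]; last by rewrite mxE ki.
by rewrite addr0 mxE eqxx.
Qed.

(** * Irreducible Clifford families: spanning, dimension and the trace formula *)

Section TraceFormula.

Variables (C : numFieldType) (n : nat) (I J : eqType).
Variables (e : I -> 'M[C]_n) (s : seq I) (w : 'M[C]_n).
Hypotheses (n_gt0 : (0 < n)%N) (He : clifford_family e) (us : uniq s).
Hypothesis irr : forall X : 'M[C]_n,
  {in s, forall i, e i *m X = X *m e i} -> exists c, X = c%:M.
Hypotheses (wunit : w \in unitmx) (we : {in s, forall i, w *m e i = - (e i *m w)}).

Let n_neq0 : n%:R != 0 :> C. Proof. by rewrite pnatr_eq0 -lt0n. Qed.

Lemma mxtrace_cliff_avg X : \tr (cliff_avg e e s X) = 2 ^+ size s * \tr X.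
Proof.
case: He => ea e2; elim: (s) => [|i r IH] /=.
  by rewrite /cliff_avg /= big_seq1 mul1mx mulmx1 mul1r.
rewrite cliff_avg_cons raddfB /= mxtrace_mulC mulmxA e2 mulNmx mul1mx.
by rewrite raddfN /= opprK IH exprS mulr_natl mulr2n mulrDl.
Qed.

Lemma cliff_avg_scalar X : cliff_avg e e s X = (2 ^+ size s / n%:R * \tr X)%:M.
Proof.
have [|c defc] := irr (X := cliff_avg e e s X).
  exact: (cliff_avg_intertwine He He X us).
have := mxtrace_cliff_avg X; rewrite defc mxtrace_scalar => cX.
by congr _%:M; rewrite mulrAC -cX -(mulr_natr c) mulfK.
Qed.

(** An inversion formula: since the averages of elementary matrices are scalar, the traces of [Y]
    against the inverse products recover [Y]. In particular the products span all matrices. *)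
Lemma cliff_prods_expand Y :
  \sum_(p <- cliff_prods e e s) \tr (p.2 *m Y) *: p.1 = (2 ^+ size s / n%:R) *: Y.
Proof.
apply/matrixP => a i; rewrite summxE mxE.
transitivity (\sum_j \sum_b cliff_avg e e s (delta_mx i j) a b * Y b j).
  under [RHS]eq_bigr do under eq_bigr do rewrite /cliff_avg summxE mulr_suml.
  under [RHS]eq_bigr do rewrite exchange_big.
  rewrite [RHS]exchange_big /=; apply: eq_bigr => p _.
  rewrite mxE /mxtrace mulr_suml; apply: eq_bigr => j _.
  rewrite mxE mulr_suml; apply: eq_bigr => b _; rewrite mulrC mulrA.
  congr (_ * _); rewrite mxE (bigD1 j) //= mxE (bigD1 i) //= !mxE !eqxx mulr1.
  rewrite !big1 ?addr0 //.
    by move=> k /negPf kj; rewrite mxE big1 ?mul0r // => c _; rewrite !mxE kj andbF mulr0.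
  by move=> k /negPf ki; rewrite mxE ki mulr0.
rewrite (bigD1 i) //= (bigD1 a) //= cliff_avg_scalar mxE eqxx mxtrace_delta eqxx.
rewrite mulr1 mulr1n !big1 ?addr0 // => [j ji|b ba].
  by rewrite big1 // => b _; rewrite cliff_avg_scalar mxtrace_delta eq_sym (negPf ji) !(mulr0, mxE, mul0rn, mul0r).
by rewrite mxE eq_sym (negPf ba) mulr0n mul0r.
Qed.

(** The trace of the averaging operator is [n * n] by the traces of the products, and [2 ^ size s]
    by its scalar values. *)
Lemma clifford_module_dim : (n * n = 2 ^ size s)%N.
Proof.
apply/eqP; rewrite -(eqr_nat C) natrM -(trace_cliff_prods e He wunit we us).
rewrite (trace_cliff_avg e e) natrX; apply/eqP.
transitivity (\sum_(a < n) (2 ^+ size s / n%:R : C)).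
  apply: eq_bigr => a _; rewrite (bigD1 a) //= big1 => [|b ba].
    by rewrite addr0 cliff_avg_scalar mxE mxtrace_delta eqxx mulr1.
  by rewrite cliff_avg_scalar mxE mxtrace_delta eq_sym (negPf ba) mulr0n.
by rewrite /= sumr_const card_ord -[_ *+ _]mulr_natr divfK.
Qed.

Variables (t : seq J) (u : J -> 'M[C]_n) (mu : J -> C) (A A' : 'M[C]_n).
Hypotheses (size_t : size t = size s)
  (Hu : forall j k, exists c, u j *m u k + u k *m u j = c%:M)
  (eu : {in s, forall i, exists c : J -> C, e i = \sum_(j <- t) c j *: u j})
  (AA' : A *m A' = 1%:M) (Au : {in t, forall j, A *m u j = mu j *: (u j *m A)}).

Fixpoint eigen_prods (r : seq J) : seq ('M[C]_n * C) :=
  if r is j :: r' then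
    eigen_prods r' ++ [seq (u j *m p.1, mu j * p.2) | p <- eigen_prods r']
  else [:: (1%:M, 1)].

Lemma size_eigen_prods r : size (eigen_prods r) = (2 ^ size r)%N.
Proof.
by elim: r => //= i r IH; rewrite size_cat size_map IH addnn -mul2n expnS.
Qed.

Lemma sum_eigen_prods r : \sum_(p <- eigen_prods r) p.2 = \prod_(j <- r) (1 + mu j).
Proof.
elim: r => [|j r IH] /=; first by rewrite big_seq1 big_nil.
by rewrite big_cat big_map big_cons /= -mulr_sumr IH mulrDl mul1r.
Qed.

Lemma eigen_prodsP r : {subset r <= t} ->
  {in eigen_prods r, forall p, A *m p.1 = p.2 *: (p.1 *m A)}.
Proof.
elim: r => [|j r IH] rt p /=.
  by rewrite inE => /eqP -> /=; rewrite mulmx1 mul1mx scale1r.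
have {}IH : {in eigen_prods r, forall p, A *m p.1 = p.2 *: (p.1 *m A)}.
  by apply: IH => k kr; apply: rt; rewrite in_cons kr orbT.
rewrite mem_cat => /orP[/IH //|/mapP[q /IH hq -> /=]].
by rewrite mulmxA Au ?rt ?mem_head // -scalemxAl -mulmxA hq -scalemxAr scalerA mulmxA.
Qed.

(** The span of the ordered products, written by splitting off the first generator so that closure
    under left multiplication can be proved by induction. *)
Fixpoint ordered_span (r : seq J) (x : 'M[C]_n) : Prop :=
  if r is j :: r' then
    exists y z, [/\ ordered_span r' y, ordered_span r' z & x = y + u j *m z]
  else exists c, x = c%:M.

Lemma ordered_spanD r x y :
  ordered_span r x -> ordered_span r y -> ordered_span r (x + y).
Proof.
elim: r x y => [|j r IH] x y /=; first by case=> c -> [d ->]; exists (c + d); rewrite raddfD.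
case=> x1 [x2 [h1 h2 ->]] [y1 [y2 [k1 k2 ->]]].
by exists (x1 + y1), (x2 + y2); split; [exact: IH|exact: IH|rewrite mulmxDr addrACA].
Qed.

Lemma ordered_spanZ r c x : ordered_span r x -> ordered_span r (c *: x).
Proof.
elim: r x => [|j r IH] x /=; first by case=> d ->; exists (c * d); rewrite scale_scalar_mx.
case=> x1 [x2 [h1 h2 ->]].
by exists (c *: x1), (c *: x2); split; [exact: IH|exact: IH|rewrite scalerDr scalemxAr].
Qed.

Lemma ordered_span1 r : ordered_span r 1%:M.
Proof.
elim: r => [|j r IH] /=; first by exists 1.
exists 1%:M, 0; split=> //; last by rewrite mulmx0 addr0.
by rewrite -(scale0r 1%:M); apply: ordered_spanZ.
Qed.

(** The relation [Hu] moves [u j] to its place, each exchange adding a multiple of a shorter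
    product; a repeated [u k] squares to half the scalar of [Hu]. *)
Lemma ordered_span_mul r : {in r, forall j x, ordered_span r x ->
  ordered_span r (u j *m x)}.
Proof.
elim: r => // k r IH j; rewrite in_cons.
have h0 : ordered_span r 0.
  by rewrite -(scale0r 1%:M); apply/ordered_spanZ/ordered_span1.
have sub x : ordered_span r x -> ordered_span (k :: r) x.
  by exists x, 0; rewrite mulmx0 addr0.
have shift x : ordered_span r x -> ordered_span (k :: r) (u k *m x).
  by exists 0, x; rewrite add0r.
case/predU1P=> [->|jr] _ [y [z [hy hz ->]]]; rewrite mulmxDr; apply: ordered_spanD.
- exact: shift.
- have [c hc] := Hu k k; apply: sub.
  have two_neq0 : 2%:R != 0 :> C by rewrite pnatr_eq0.
  have -> : u k *m (u k *m z) = (c / 2) *: z.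
    rewrite mulmxA -mul_scalar_mx; congr (_ *m _).
    have : 2%:R *: (u k *m u k) = c%:M by rewrite scaler_nat mulr2n.
    by move/(canRL (scalerK two_neq0)) => ->; rewrite scale_scalar_mx mulrC.
  exact: ordered_spanZ.
- by apply/sub/IH.
- have [c hc] := Hu j k.
  have -> : u j *m (u k *m z) = c *: z + u k *m ((-1) *: (u j *m z)).
    by rewrite -mul_scalar_mx -hc mulmxDl scaleN1r mulmxN !mulmxA addrK.
  by apply: ordered_spanD; [apply/sub/ordered_spanZ|apply/shift/ordered_spanZ/IH].
Qed.

(** The products of the [e i] span by [cliff_prods_expand], and each [e i] is a combination of the
    [u j]. *)
Lemma ordered_span_all Y : ordered_span t Y.
Proof.
have h0 : ordered_span t 0.
  by rewrite -(scale0r 1%:M); apply/ordered_spanZ/ordered_span1.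
have hp r : {subset r <= s} -> {in cliff_prods e e r, forall p, ordered_span t p.1}.
  elim: r => [|i r IH] rs p /=; first by rewrite inE => /eqP ->; apply: ordered_span1.
  have {}IH := IH (fun k kr => rs k (mem_behead (s := i :: r) kr)).
  rewrite mem_cat => /orP[/IH //|/mapP[q /IH hq -> /=]].
  have [c ->] := eu (rs i (mem_head _ _)); rewrite mulmx_suml big_seq.
  apply: (big_ind (ordered_span t)) => // [|j jt]; first exact: ordered_spanD.
  by rewrite -scalemxAl; apply/ordered_spanZ/ordered_span_mul.
have /(canLR (scalerK _)) <- := cliff_prods_expand Y; last first.
  by rewrite mulf_neq0 ?invr_neq0 // expf_neq0 // pnatr_eq0.
apply: ordered_spanZ; rewrite big_seq.
apply: (big_ind (ordered_span t)) => // [|p ps]; first exact: ordered_spanD.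
exact/ordered_spanZ/(hp s).
Qed.

Lemma ordered_span_eigen r x :
  ordered_span r x -> x \in <<[seq p.1 | p <- eigen_prods r]>>%VS.
Proof.
elim: r x => [|j r IH] x /=.
  case=> c ->; have h : (1%:M : 'M[C]_n) \in <<[:: 1%:M]>>%VS by rewrite memv_span ?mem_head.
  by have := memvZ c h; rewrite scalemx1.
case=> y [z [/IH hy /IH hz ->]]; rewrite map_cat span_cat memv_add //.
rewrite -map_comp; have := memv_img (linfun (mulmx (u j))) hz.
by rewrite limg_span -map_comp lfunE /=; under eq_map do rewrite /= lfunE.
Qed.

(* The left-hand side is the trace of conjugation by A on matrices, which is
   diagonal in the basis of ordered products of the u j. *)
Theorem clifford_trace_formula : \tr A * \tr A' = \prod_(j <- t) (1 + mu j).
Proof.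
set ps := eigen_prods t; pose X := [seq p.1 | p <- ps].
have Xfull : <<X>>%VS = fullv.
  apply/vspaceP => x; rewrite memvf; apply/ordered_span_eigen/ordered_span_all.
(* The [2 ^ size t] spanning products are as many as the dimension [n * n], hence form a basis. *)
have Xfree : free X.
  by rewrite /free Xfull dimvf /= size_map size_eigen_prods size_t -clifford_module_dim.
pose Xt := in_tuple X.
have ltX (k : 'I_(size X)) : (k < size ps)%N by rewrite -[X in (_ < X)%N](size_map fst).
have XE (k : 'I_(size X)) : Xt`_k = (nth (0, 0) ps k).1.
  by rewrite /= (nth_map (0, 0)).
have AX (k : 'I_(size X)) : A *m Xt`_k *m A' = (nth (0, 0) ps k).2 *: Xt`_k.
  rewrite XE (@eigen_prodsP t) ?mem_nth //.
  by rewrite -scalemxAl -mulmxA AA' mulmx1.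
have -> : \tr A * \tr A' = \sum_a \sum_b (A *m delta_mx a b *m A') a b.
  rewrite big_distrlr /=; apply: eq_bigr => a _; apply: eq_bigr => b _.
  rewrite mxE (bigD1 b) //= mxE (bigD1 a) //= !mxE !eqxx mulr1 !big1 ?addr0 //.
    by move=> k /negPf kb; rewrite mxE big1 ?mul0r // => c _; rewrite !mxE kb andbF mulr0.
  by move=> k /negPf kb; rewrite mxE kb mulr0.
transitivity (\sum_(k < size X) \sum_a \sum_b
    (nth (0, 0) ps k).2 * (coord Xt k (delta_mx a b) * Xt`_k a b)).
  rewrite [RHS]exchange_big /=; apply: eq_bigr => a _.
  rewrite [RHS]exchange_big /=; apply: eq_bigr => b _.
  have dX : delta_mx a b \in <<Xt>>%VS by rewrite Xfull memvf.
  rewrite {1}(coord_span dX) mulmx_sumr mulmx_suml summxE.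
  by apply: eq_bigr => k _; rewrite -scalemxAr -scalemxAl AX !mxE mulrCA.
transitivity (\sum_(k < size X) (nth (0, 0) ps k).2).
  apply: eq_bigr => k _; rewrite -[RHS]mulr1.
  have <- : coord Xt k Xt`_k = 1 by rewrite (coord_free _ _ (Xfree : free Xt)) eqxx.
  rewrite [X in _ = _ * coord _ _ X]matrix_sum_delta linear_sum mulr_sumr.
  apply: eq_bigr => a _; rewrite linear_sum mulr_sumr; apply: eq_bigr => b _.
  by rewrite linearZ /= [coord _ _ _ * _]mulrC.
rewrite -sum_eigen_prods (big_nth (0, 0)) big_mkord.
by rewrite size_map.
Qed.

End TraceFormula.

(** * Diagonalization, orthonormal bases and Molien series *)

(** The minimal polynomial divides [X^k - 1], which is separable in characteristic 0. *)
Lemma finite_order_diag (C : numClosedFieldType) n (A : 'M[C]_n) k :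
  (0 < k)%N -> A ^+ k = 1 ->
  exists P : 'M[C]_n, exists2 d : 'rV[C]_n, P \in unitmx /\ A *m P = P *m diag_mx d
    & forall j, d 0 j ^+ k = 1.
Proof.
move=> k_gt0; case: n A => [|n] A Ak.
  by exists 1%:M, 0; [split; [exact: unitmx1|rewrite [LHS]flatmx0 flatmx0]|case].
have [rs] := closed_field_poly_normal ('X^k - 1 : {poly C}).
rewrite (monicP (monic_Xn_sub_1 _ k_gt0)) scale1r => Xk.
have urs : uniq rs.
  by rewrite -separable_prod_XsubC -Xk separable_Xn_sub_1 // pnatr_eq0 -lt0n.
have /mxpoly.diagonalizableP[] : exists2 rs, uniq rs & mxminpoly A %| \prod_(x <- rs) ('X - x%:P).
  exists rs => //; rewrite -Xk; apply: mxminpoly_min.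
  by rewrite rmorphB rmorph1 rmorphXn /= horner_mx_X Ak subrr.
move=> P Pu /(mxpoly.diagonalizable_forLR Pu)[d]; rewrite mxpoly.conjVmx // => defA.
have AP : A *m invmx P = invmx P *m diag_mx d by rewrite defA mulmxK // unitmx_inv.
exists (invmx P), d => [|j]; first by rewrite unitmx_inv.
have Ai i : A ^+ i *m invmx P = invmx P *m (diag_mx d) ^+ i.
  elim: i => [|i IH]; first by rewrite !expr0 mulmx1 mul1mx.
  by rewrite exprSr -mulmxE -mulmxA AP mulmxA IH -mulmxA mulmxE -exprSr.
have /(congr1 (fun X => (P *m X) j j)) := Ai k.
rewrite Ak mul1mx mulKVmx // mulmxV // mxE eqxx => Dk.
rewrite [RHS]Dk; elim: (k) => [|i IH]; first by rewrite !expr0 mxE eqxx.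
rewrite !exprSr -mulmxE mxE (bigD1 j) //= -IH mxE eqxx big1 ?addr0 // => i' /negPf ji.
by rewrite [diag_mx _ _ _]mxE ji mulr0n mulr0.
Qed.

Section FiniteOrderRepr.

Variables (C : numClosedFieldType) (gT : finGroupType) (G : {group gT}) (n : nat).
Variable rG : mx_representation C G n.

Lemma repr_diag g : g \in G ->
  exists P : 'M[C]_n, exists2 d : 'rV[C]_n,
    P \in unitmx /\ rG g *m P = P *m diag_mx d & forall j, `|d 0 j| = 1.
Proof.
move=> Gg; have rX k : rG (g ^+ k)%g = rG g ^+ k.
  elim: k => [|k IH]; first by rewrite repr_mx1.
  by rewrite expgS exprS repr_mxM ?groupX // IH.
have [|P [d hP dk]] := finite_order_diag (order_gt0 g) (A := rG g).
  by rewrite -rX expg_order repr_mx1.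
exists P, d => // j; apply/eqP.
by rewrite -(pexpr_eq1 (order_gt0 g)) // -normrX dk normr1.
Qed.

Lemma mxtrace_reprV g : g \in G -> \tr (rG g^-1%g) = (\tr (rG g))^*.
Proof.
move=> Gg; have [P [d [Pu gP] d1]] := repr_diag Gg.
have d_neq0 j : d 0 j != 0 by rewrite -normr_eq0 d1 oner_eq0.
pose d' : 'rV_n := \row_j (d 0 j)^-1.
have dd' : diag_mx d *m diag_mx d' = 1%:M.
  apply/matrixP => i j; rewrite mul_diag_mx !mxE.
  by case: eqP => [->|]; rewrite ?mulr1n ?mulfV ?mulr0n ?mulr0.
have gP' : rG g^-1%g *m P = P *m diag_mx d'.
  by rewrite -[P in LHS]mulmx1 -dd' (mulmxA P) -gP !mulmxA -repr_mxM ?groupV // mulVg repr_mx1 mul1mx.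
have tr A D : A *m P = P *m diag_mx D -> \tr A = \sum_j D 0 j.
  by move=> AP; rewrite -[A](mulmxK Pu) AP mxtrace_mulC mulKmx // mxtrace_diag.
rewrite (tr _ _ gP) (tr _ _ gP') rmorph_sum; apply: eq_bigr => j _.
by rewrite mxE invC_norm d1 expr1n invr1 mul1r.
Qed.

End FiniteOrderRepr.

(** Induction on [l]: [P0] clears the first row and column, and the Schur complement [S] is again
    positive definite, being the form on the orthogonal of the first basis vector. *)
Lemma orthonormal_basis (R : rcfType) (l : nat) (B : 'M[R]_l) :
  B^T = B -> (forall x : 'cV[R]_l, x != 0 -> 0 < (x^T *m B *m x) 0 0) ->
  exists2 P : 'M[R]_l, P \in unitmx & P^T *m B *m P = 1%:M.
Proof.
elim: l B => [|l IH] B Bs Bp.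
  by exists 1%:M; [exact: unitmx1|rewrite [LHS]flatmx0 flatmx0].
rewrite -[l.+1]/(1 + l)%N in B Bs Bp *.
pose b := B 0 0; pose v := ursubmx B; pose B' := drsubmx B.
have defB : B = block_mx b%:M v v^T B'.
  rewrite -[LHS]submxK [ulsubmx B]mx11_scalar !mxE; congr block_mx.
    by congr (B _ _)%:M; apply: val_inj.
  by rewrite /v trmx_ursub Bs.
have b_gt0 : 0 < b.
  have := Bp (delta_mx 0 0); rewrite trmx_delta -rowE -colE !mxE; apply.
  by apply/eqP => /matrixP/(_ 0 0)/eqP; rewrite !mxE !eqxx oner_eq0.
have b0 : b != 0 by rewrite gt_eqF.
pose P0 : 'M_(1 + l) := block_mx 1%:M (- (b^-1 *: v)) 0 1%:M.
pose S := B' - b^-1 *: (v^T *m v).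
have B's : B'^T = B' by rewrite /B' trmx_drsub Bs.
have P0B : P0^T *m B *m P0 = block_mx b%:M 0 0 S.
  rewrite defB tr_block_mx !mulmx_block !trmx1 !trmx0 !(mul0mx, mulmx0, mul1mx, mulmx1, addr0, add0r).
  have tv : (- (b^-1 *: v))^T = - (b^-1 *: v^T) by rewrite raddfN /= linearZ.
  have e1 : (- (b^-1 *: v))^T *m b%:M + v^T = 0.
    by rewrite tv mul_mx_scalar scalerN scalerA mulfV // scale1r addNr.
  have e2 : b%:M *m (- (b^-1 *: v)) + v = 0.
    by rewrite mul_scalar_mx scalerN scalerA mulfV // scale1r addNr.
  by rewrite e1 mul0mx add0r e2 /S tv mulNmx -scalemxAl addrC.
have [|y y0|P1 P1u P1S] := IH S.
- by rewrite /S linearB linearZ /= trmx_mul trmxK B's.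
- have x0 : P0 *m col_mx 0 y != 0.
    rewrite mul_block_col mul0mx mulmx0 mul1mx !add0r.
    by apply: contraNneq y0 => /(congr1 dsubmx); rewrite col_mxKd linear0 => ->.
  have := Bp _ x0; rewrite trmx_mul !mulmxA -(mulmxA _ _ B) -(mulmxA _ _ P0) P0B.
  by rewrite tr_col_mx trmx0 mul_row_block mul_row_col !(mul0mx, mulmx0, add0r).
have sb : Num.sqrt b != 0 by rewrite gt_eqF // sqrtr_gt0.
exists (P0 *m block_mx ((Num.sqrt b)^-1)%:M 0 0 P1).
  rewrite unitmx_mul !unitmxE !det_ublock !det1 mul1r unitr1 /=.
  by rewrite det_scalar expr1 unitrM unitfE invr_eq0 sb -unitmxE.
rewrite trmx_mul !mulmxA -(mulmxA _ _ B) -(mulmxA _ _ P0) P0B.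
rewrite tr_block_mx !mulmx_block !trmx0 !(mul0mx, mulmx0, addr0, add0r) P1S.
have bb : (Num.sqrt b)^-1 * b * (Num.sqrt b)^-1 = 1.
  have := sqr_sqrtr (ltW b_gt0); set r := Num.sqrt b in sb * => <-.
  by rewrite expr2 mulrA mulVf // mul1r mulfV.
by rewrite tr_scalar_mx -!scalar_mxM bb -scalar_mx_block.
Qed.

(** * Power series expansions of rational functions *)

Section Expansion.

Variable F : fieldType.
Implicit Types (f g : {fraction {poly F}}) (s t : nat -> F).

Lemma eq_has_expansion f s t : s =1 t -> has_expansion f s -> has_expansion f t.
Proof.
move=> st [N [D [D0 fE Ns]]]; exists N, D; split=> // n; rewrite Ns.
by apply: eq_bigr => k _; rewrite st.
Qed.

Lemma has_expansion0 : has_expansion (0 : {fraction {poly F}}) (fun=> 0).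
Proof.
exists 0, 1; split=> [||n]; first by rewrite coefC oner_eq0.
  by rewrite tofrac0 mul0r.
by rewrite coef0 big1 // => k _; rewrite mulr0.
Qed.

Lemma has_expansionZ c f s :
  has_expansion f s -> has_expansion (qcst c * f) (fun n => c * s n).
Proof.
case=> N [D [D0 -> Ns]]; exists (c%:P * N), D; split=> // [|n].
  by rewrite tofracM mulrA.
by rewrite coefCM Ns mulr_sumr; apply: eq_bigr => k _; rewrite mulrCA.
Qed.

Lemma has_expansionD f g s t : has_expansion f s -> has_expansion g t ->
  has_expansion (f + g) (fun n => s n + t n).
Proof.
case=> [N [D [D0 -> Ns]]] [M [E [E0 -> Mt]]].
have D_neq0 : tofrac D != 0 by rewrite tofrac_eq0; apply: contraNneq D0 => ->; rewrite coef0.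
have E_neq0 : tofrac E != 0 by rewrite tofrac_eq0; apply: contraNneq E0 => ->; rewrite coef0.
exists (N * E + M * D), (D * E); split=> [||n].
- by rewrite coef0M mulf_neq0.
- rewrite (addf_div (tofrac N) (tofrac M) D_neq0 E_neq0) tofracD !tofracM; reflexivity.
(* Truncating the series after degree [n] turns the convolutions into coefficients of polynomial
   products, up to degree [n]. *)
pose S (u : nat -> F) := \poly_(k < n.+1) u k.
have conv (P Q : {poly F}) u :
    (forall m, P`_m = \sum_(k < m.+1) Q`_k * u (m - k)%N) ->
    forall m, (m <= n)%N -> P`_m = (Q * S u)`_m.
  move=> PQ m mn; rewrite PQ coefM; apply: eq_bigr => k _.
  by rewrite coef_poly ltnS (leq_trans (leq_subr _ _) mn).
have conv2 (P Q T : {poly F}) u :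
    (forall m, P`_m = \sum_(k < m.+1) Q`_k * u (m - k)%N) ->
    (P * T)`_n = (Q * T * S u)`_n.
  move=> PQ; rewrite mulrAC coefM [RHS]coefM; apply: eq_bigr => k _.
  by rewrite -(conv _ _ _ PQ) // -ltnS.
rewrite coefD (conv2 _ _ E _ Ns) (conv2 _ _ D _ Mt) (mulrC E) -coefD -mulrDr.
rewrite coefM; apply: eq_bigr => k _; congr (_ * _).
by rewrite coefD !coef_poly ltnS leq_subr.
Qed.

Lemma has_expansion_sum (I : eqType) (r : seq I) (f : I -> {fraction {poly F}})
    (s : I -> nat -> F) :
  {in r, forall i, has_expansion (f i) (s i)} ->
  has_expansion (\sum_(i <- r) f i) (fun n => \sum_(i <- r) s i n).
Proof.
elim: r => [|i r IH] fs.
  rewrite big_nil; apply: eq_has_expansion has_expansion0 => n.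
  by rewrite big_nil.
rewrite big_cons; apply: eq_has_expansion (has_expansionD (fs i (mem_head _ _)) (IH _)).
  by move=> n; rewrite big_cons.
by move=> j jr; apply: fs; rewrite in_cons jr orbT.
Qed.

End Expansion.

(** * Molien's formula for symmetric powers *)

Section Molien.

Variables (F : fieldType) (l : nat).

(** The complete homogeneous symmetric polynomial of degree [n] in the entries of [d]. *)
Definition complete_sum (d : 'rV[F]_l) (n : nat) : F :=
  \sum_(i < #|hmonom l n|) \prod_j d 0 j ^+ (bmnm (enum_val i)) j.

Lemma mxtrace_sym_diag n (d : 'rV[F]_l) : \tr (sym_mx n (diag_mx d)) = complete_sum d n.
Proof.
apply: eq_bigr => i _; rewrite mxE lin_substX.
set m := bmnm _.
have -> : \prod_(j < l) (\sum_k diag_mx d k j *: 'X_k) ^+ m j =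
    (\prod_j d 0 j ^+ m j) *: 'X_[m] :> {mpoly F[l]}.
  rewrite mpolyXE_id -scaler_prod; apply: eq_bigr => j _.
  rewrite (bigD1 j) //= mxE eqxx mulr1n big1 ?addr0 ?exprZn // => k /negPf kj.
  by rewrite mxE kj mulr0n scale0r.
by rewrite linearZ /= mcoeffX eqxx mulr1.
Qed.

Lemma mxtrace_sym_conj n (A P : 'M[F]_l) d :
  P \in unitmx -> A *m P = P *m diag_mx d -> \tr (sym_mx n A) = complete_sum d n.
Proof.
move=> Pu AP; have -> : A = P *m diag_mx d *m invmx P by rewrite -AP mulmxK.
by rewrite !sym_mxM mxtrace_mulC mulmxA -sym_mxM mulVmx // sym_mx1 mul1mx mxtrace_sym_diag.
Qed.

Lemma coef_prod_geom (d : 'rV[F]_l) N n : (n <= N)%N ->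
  (\prod_(j < l) \sum_(k < N.+1) (d 0 j *: 'X) ^+ k)`_n = complete_sum d n.
Proof.
move=> nN; rewrite bigA_distr_bigA /= coef_sum.
transitivity (\sum_(f : {ffun 'I_l -> 'I_N.+1} | \sum_j (f j : nat) == n)
    \prod_j d 0 j ^+ f j).
  rewrite [RHS]big_mkcond; apply: eq_bigr => f _.
  have -> : \prod_j (d 0 j *: 'X) ^+ f j =
      (\prod_j d 0 j ^+ f j) *: 'X^(\sum_j (f j : nat)) :> {poly F}.
    under eq_bigr do rewrite exprZn.
    by rewrite scaler_prod -expr_sum.
  by rewrite coefZ coefXn eq_sym; case: eqP; rewrite ?mulr1 ?mulr0.
have m0_lt : (mdeg (0 : 'X_{1..l})%MM < n.+1)%N by rewrite mdeg0.
pose m0 := BMultinom m0_lt.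
(* [h] and [h'] match exponent functions of sum [n] with monomials of degree [n]. The defaults of
   [insubd] and [inord] are not reached there, as exponents are at most [n <= N]. *)
pose h (f : {ffun 'I_l -> 'I_N.+1}) : 'X_{1..l < n.+1} :=
  insubd m0 [multinom (f j : nat) | j < l].
pose h' (m : 'X_{1..l < n.+1}) : {ffun 'I_l -> 'I_N.+1} := [ffun j => inord (bmnm m j)].
rewrite /complete_sum -(big_enum_val (fun m : 'X_{1..l < n.+1} => \prod_j d 0 j ^+ (bmnm m) j)).
have h'E (m : 'X_{1..l < n.+1}) j : (h' m j : nat) = bmnm m j.
  rewrite ffunE inordK // ltnS (leq_trans _ nN) //.
  have := bmdeg m; rewrite ltnS; apply: leq_trans.
  by rewrite mdegE (bigD1 j) //= leq_addr.
have hE (f : {ffun 'I_l -> 'I_N.+1}) : (\sum_j (f j : nat) == n)%N -> bmnm (h f) = [multinom (f j : nat) | j < l].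
  move=> /eqP fn; rewrite /h insubdK // unfold_in /= mdegE.
  by under eq_bigr do rewrite mnmE; rewrite fn.
rewrite (reindex_onto h h') /= => [|m /eqP mn]; last first.
  have e : (\sum_j (h' m j : nat) == n)%N.
    by under eq_bigr do rewrite h'E; rewrite -mdegE mn.
  apply/val_inj; rewrite /= hE //; apply/mnmP => j; rewrite mnmE h'E //.
apply: eq_big => [f|f fn]; last first.
  by apply: eq_bigr => j _; rewrite hE // mnmE.
apply/idP/andP => [fn|[/eqP hn /eqP <-]]; last first.
  by under eq_bigr do rewrite h'E; rewrite -mdegE; apply/eqP; exact: hn.
split.
  rewrite unfold_in /= hE // mdegE; by under eq_bigr do rewrite mnmE.
by apply/eqP/ffunP => j; apply: val_inj; rewrite [LHS]h'E hE // mnmE.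
Qed.

(** Multiplying [1 - d_j X] by its geometric series truncated after degree [n] leaves only an error
    of degree [n.+1], invisible in the coefficient of degree [n]. *)
Lemma complete_sum_conv (d : 'rV[F]_l) n :
  (1 : {poly F})`_n = \sum_(k < n.+1) (\prod_j (1 - d 0 j *: 'X))`_k * complete_sum d (n - k).
Proof.
pose T : {poly F} := \prod_(j < l) \sum_(k < n.+1) (d 0 j *: 'X) ^+ k.
transitivity ((\prod_j (1 - d 0 j *: 'X) * T)`_n); last first.
  by rewrite coefM; apply: eq_bigr => k _; rewrite coef_prod_geom // leq_subr.
rewrite -big_split /=.
suff [q ->] : exists q : {poly F}, \prod_j ((1 - d 0 j *: 'X) * \sum_(k < n.+1) (d 0 j *: 'X) ^+ k)
    = 1 + 'X^(n.+1) * q.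
  by rewrite coefD coefXnM ltnSn addr0.
apply: (big_ind (fun p => exists q : {poly F}, p = 1 + 'X^(n.+1) * q)) => [|p r [q ->] [q' ->]|j _].
- by exists 0; rewrite mulr0 addr0.
- exists (q + q' + q * ('X^(n.+1) * q')).
  by rewrite mulrDl mul1r !mulrDr mulr1 !mulrA addrACA -!addrA; congr (_ + _); rewrite addrCA.
exists (- (d 0 j ^+ n.+1)%:P).
by rewrite -[1 - _]opprB mulNr -subrX1 opprB exprZn mulrN mulrC mul_polyC.
Qed.

End Molien.

(** Stated over a commutative ring because it is also applied to matrices of polynomials in q. *)
Lemma det_one_sub_conj (F : comNzRingType) l (A P Q D : 'M[F]_l) :
  P *m Q = 1%:M -> A *m P = P *m D -> \det (1%:M - A) = \det (1%:M - D).
Proof.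
move=> PQ AP; have QP := mulmx1C PQ.
have -> : 1%:M - D = Q *m (1%:M - A) *m P.
  by rewrite mulmxBr mulmxBl mulmx1 QP -!mulmxA AP mulmxA QP mul1mx.
by rewrite -[LHS]mul1r -(det1 F l) -QP !det_mulmx mulrAC.
Qed.

Lemma det_one_sub_diag (F : comNzRingType) l (d : 'rV[F]_l) :
  \det (1%:M - diag_mx d) = \prod_j (1 - d 0 j).
Proof.
have -> : 1%:M - diag_mx d = diag_mx (\row_j (1 - d 0 j)).
  by apply/matrixP => i j; rewrite !mxE; case: eqP => _; rewrite ?mulr1n ?mulr0n ?subr0.
by rewrite det_diag; apply: eq_bigr => j _; rewrite mxE.
Qed.

Lemma det_expansion (F : fieldType) l (A P : 'M[F]_l) d :
  P \in unitmx -> A *m P = P *m diag_mx d ->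
  has_expansion (\det (1%:M - qvar F *: map_mx (@qcst F) A))^-1
    (fun n => \tr (sym_mx n A)).
Proof.
move=> Pu AP; pose D : {poly F} := \prod_j (1 - d 0 j *: 'X).
have -> : \det (1%:M - qvar F *: map_mx (@qcst F) A) = tofrac D.
  pose Ap := 'X *: map_mx polyC A.
  have -> : 1%:M - qvar F *: map_mx (@qcst F) A = map_mx (@tofrac {poly F}) (1%:M - Ap).
    by apply/matrixP => i j; rewrite !mxE tofracB tofracM; congr (_ - _); case: eqP.
  rewrite det_map_mx; congr (tofrac _).
  rewrite (@det_one_sub_conj _ _ _ (map_mx polyC P) (map_mx polyC (invmx P))
     (diag_mx (\row_j (d 0 j *: 'X)))).
  - by rewrite det_one_sub_diag; apply: eq_bigr => j _; rewrite mxE.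
  - by rewrite -map_mxM mulmxV // map_mx1.
  rewrite -scalemxAl -map_mxM AP map_mxM scalemxAr; congr (_ *m _).
  apply/matrixP => i j; rewrite !mxE; case: eqP => _; rewrite ?mulr1n ?mulr0n ?mulr0 //.
  by rewrite -mul_polyC mulrC.
have D0 : D`_0 = 1.
  rewrite -horner_coef0 horner_prod big1 // => j _.
  by rewrite hornerD hornerN hornerZ hornerX hornerC mulr0 subr0.
exists 1, D; split=> [||n]; first by rewrite D0 oner_eq0.
  by rewrite tofrac1 mul1r.
rewrite (complete_sum_conv d n); apply: eq_bigr => k _.
by rewrite (mxtrace_sym_conj _ Pu AP).
Qed.

(** * Clifford modules *)

Section Generation.

Variables (R : realType) (l : nat) (B : 'M[R]_l) (Cl : clifford B).

Lemma cl_graded_gen x : cl_graded true (cl_gen Cl x).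
Proof.
rewrite -[cl_gen Cl x]mulr1 -[1]scale1r.
exact: (ClGen x (ClScalar Cl 1)).
Qed.

Lemma cl_gradedZ b k (a : Cl) : cl_graded b a -> cl_graded b (k *: a).
Proof.
move=> Ga; elim: Ga k => {b a} [k' k|b x a _ IH k|b a a' _ IH _ IH' k|b k].
- by rewrite scalerA; apply: ClScalar.
- by rewrite scalerAr; apply/ClGen/IH.
- by rewrite scalerDr; apply: ClAdd.
- by rewrite scaler0; apply: ClZero.
Qed.

Lemma cl_gradedM b b' (a a' : Cl) :
  cl_graded b a -> cl_graded b' a' -> cl_graded (b (+) b') (a * a').
Proof.
move=> Ga Ga'; elim: Ga => {b a} [k|b x a _ IH|b a a1 _ IH _ IH1|b].
- by rewrite mulr_algl; apply: cl_gradedZ.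
- by rewrite -mulrA addNb; apply: ClGen.
- by rewrite mulrDl; apply: ClAdd.
- by rewrite mul0r; apply: ClZero.
Qed.

(* By the universal property, C(E) retracts onto its subalgebra generated by E,
   which is therefore C(E) itself. *)
Definition cl_generated (a : Cl) : Prop :=
  exists a0 a1, [/\ cl_graded false a0, cl_graded true a1 & a = a0 + a1].

Definition cl_genpred : {pred Cl} := fun a => `[< cl_generated a >].

Lemma cl_genpred_subalg : GRing.subalg_closed cl_genpred.
Proof.
split=> [|k a b|a b].
- by apply/asboolP; exists 1%:A, 0; split; [exact: ClScalar|exact: ClZero|rewrite scale1r addr0].
- move=> /asboolP[a0 [a1 [h0 h1 ->]]] /asboolP[b0 [b1 [k0 k1 ->]]]; apply/asboolP.
  exists (k *: a0 + b0), (k *: a1 + b1).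
  by split; [apply: ClAdd => //; exact: cl_gradedZ..|rewrite scalerDr addrACA].
- move=> /asboolP[a0 [a1 [h0 h1 ->]]] /asboolP[b0 [b1 [k0 k1 ->]]]; apply/asboolP.
  exists (a0 * b0 + a1 * b1), (a0 * b1 + a1 * b0); split.
  + by apply: ClAdd; [exact: cl_gradedM h0 k0|exact: cl_gradedM h1 k1].
  + by apply: ClAdd; [exact: cl_gradedM h0 k1|exact: cl_gradedM h1 k0].
  + by rewrite mulrDl !mulrDr [a1 * b0 + _]addrC addrACA.
Qed.

HB.instance Definition _ := GRing.isSubalgClosed.Build R Cl cl_genpred cl_genpred_subalg.

Record cl_sub := ClSub { cl_val :> Cl; _ : cl_val \in cl_genpred }.
HB.instance Definition _ := [isSub for cl_val].
HB.instance Definition _ := [Choice of cl_sub by <:].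
HB.instance Definition _ := [SubChoice_isSubAlgebra of cl_sub by <:].

Lemma cl_gen_in x : cl_gen Cl x \in cl_genpred.
Proof.
apply/asboolP; exists 0, (cl_gen Cl x).
by split; [exact: ClZero|exact: cl_graded_gen|rewrite add0r].
Qed.

Definition cl_sub_gen (x : 'cV[R]_l) : cl_sub := ClSub (cl_gen_in x).

Lemma cl_sub_gen_linear : linear cl_sub_gen.
Proof. by move=> k x y; apply: val_inj; rewrite /= linearP. Qed.

HB.instance Definition _ :=
  GRing.isLinear.Build R 'cV[R]_l cl_sub _ cl_sub_gen cl_sub_gen_linear.

Definition cl_incl (x : cl_sub) : Cl := \val x.

Lemma cl_incl_linear : linear cl_incl.
Proof. by move=> k x y; rewrite /cl_incl linearP. Qed.

Lemma cl_incl_monoid : monoid_morphism cl_incl.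
Proof. by split=> [|x y]; rewrite /cl_incl ?rmorph1 ?rmorphM. Qed.

HB.instance Definition _ :=
  GRing.isLinear.Build R cl_sub Cl _ cl_incl cl_incl_linear.
HB.instance Definition _ :=
  GRing.isMonoidMorphism.Build cl_sub Cl cl_incl cl_incl_monoid.

Lemma cl_generatedP (a : Cl) : cl_generated a.
Proof.
have [x y|g gP] := @cl_lift _ _ _ Cl cl_sub cl_sub_gen.
  by apply: val_inj; rewrite /= cl_genP.
pose h : {lrmorphism Cl -> Cl} := cl_incl \o g.
have <- : h a = a.
  apply: (@cl_lift_uniq _ _ _ Cl Cl h idfun) => x /=.
  by rewrite gP.
exact/asboolP/(valP (g a)).
Qed.

(** Left multiplication by vectors generates everything, so intertwining relations need only be
    checked on [E]. *)
Lemma cl_ind (P : Cl -> Prop) :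
  (forall k, P k%:A) -> (forall x a, P a -> P (cl_gen Cl x * a)) ->
  (forall a b, P a -> P b -> P (a + b)) -> forall a, P a.
Proof.
move=> P1 PM PD a; have P0 : P 0 by rewrite -(scale0r 1).
have PG b c : cl_graded b c -> P c.
  by elim=> {b c} // [b x c _ /PM|b c c' _ Pc _]; [exact|exact: PD].
by have [a0 [a1 [/PG h0 /PG h1 ->]]] := cl_generatedP a; apply: PD.
Qed.

End Generation.

(** * Trace formula for a Clifford action of [E] with [k] additional roots of -1 *)

Section VectorTrace.

Variables (R : realType) (l k N : nat) (B : 'M[R]_l).
Variables (phi : 'cV[R]_l -> 'M[R[i]]_N) (h : 'I_k -> 'M[R[i]]_N) (w : 'M[R[i]]_N).

Hypotheses (N_gt0 : (0 < N)%N)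
  (phiP : forall a x y, phi (a *: x + y) = (a%:C)%C *: phi x + phi y)
  (phi_rel : forall x y,
     phi x *m phi y + phi y *m phi x = ((- (2 * Defs.form B x y))%:C)%C%:M)
  (Hh : clifford_family h) (phi_h : forall x i, phi x *m h i = - (h i *m phi x))
  (irr : forall X, (forall x, phi x *m X = X *m phi x) ->
     (forall i, h i *m X = X *m h i) -> exists c, X = c%:M)
  (w_unit : w \in unitmx)
  (w_phi : forall x, w *m phi x = - (phi x *m w))
  (w_h : forall i, w *m h i = - (h i *m w)).

Let phi0 : phi 0 = 0.
Proof.
have := phiP (-1) 0 0; rewrite scaler0 addr0 => ->.
by rewrite rmorphN rmorph1 scaleN1r addNr.
Qed.

Let phi_sum (I : Type) (r : seq I) (a : I -> R) (x : I -> 'cV[R]_l) :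
  phi (\sum_(i <- r) a i *: x i) = \sum_(i <- r) (a i)%:C%C *: phi (x i).
Proof.
by elim: r => [|i r IH]; rewrite ?big_nil ?phi0 // !big_cons phiP IH.
Qed.

(** The complex-linear extension of [phi], needed because the eigenvectors of a real orthogonal map
    are complex. *)
Definition cphi (v : 'cV[R[i]]_l) : 'M[R[i]]_N :=
  \sum_j v j 0 *: phi (delta_mx j 0).

Let col_sum_delta (K : pzRingType) (x : 'cV[K]_l) : x = \sum_j x j 0 *: delta_mx j 0.
Proof.
rewrite {1}[x]matrix_sum_delta; apply: eq_bigr => j _.
by rewrite big_ord1.
Qed.

Lemma cphi_map x : cphi (map_mx (real_complex R) x) = phi x.
Proof.
rewrite {2}[x]col_sum_delta phi_sum; apply: eq_bigr => j _.
by rewrite mxE.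
Qed.

Lemma cphi_sum (I : Type) (r : seq I) (a : I -> R[i]) (x : I -> 'cV[R[i]]_l) :
  cphi (\sum_(i <- r) a i *: x i) = \sum_(i <- r) a i *: cphi (x i).
Proof.
rewrite /cphi; under [RHS]eq_bigr do rewrite scaler_sumr.
rewrite [RHS]exchange_big; apply: eq_bigr => j _.
rewrite summxE scaler_suml; apply: eq_bigr => i _.
by rewrite mxE scalerA.
Qed.

Lemma cphi_rel u v : exists c, cphi u *m cphi v + cphi v *m cphi u = c%:M.
Proof.
exists (\sum_j \sum_i u j 0 * v i 0 *
   ((- (2 * Defs.form B (delta_mx j 0) (delta_mx i 0)))%:C)%C).
rewrite mulmx_suml mulmx_sumr -big_split /= raddf_sum; apply: eq_bigr => j _.
rewrite mulmx_sumr mulmx_suml -big_split /= raddf_sum; apply: eq_bigr => i _.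
rewrite -!scalemxAl -!scalemxAr !scalerA (mulrC (v i 0)) -scalerDr phi_rel.
by rewrite scale_scalar_mx.
Qed.

Let index : eqType := ('I_l + 'I_k)%type.
Let all_index : seq index := map inl (enum 'I_l) ++ map inr (enum 'I_k).

Let inl_inj : injective (@inl 'I_l 'I_k). Proof. by move=> i j []. Qed.
Let inr_inj : injective (@inr 'I_l 'I_k). Proof. by move=> i j []. Qed.

Let index_uniq : uniq all_index.
Proof.
rewrite cat_uniq (map_inj_uniq inl_inj) (map_inj_uniq inr_inj) !enum_uniq andbT /=.
apply/hasPn => _ /mapP[i _ ->].
by apply/negP => /mapP[].
Qed.

Let in_index i : i \in all_index.
Proof.
by rewrite mem_cat; case: i => i; rewrite map_f ?mem_enum ?orbT.
Qed.

Variables (P : 'M[R]_l).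
Hypotheses (P_unit : P \in unitmx) (PB : P^T *m B *m P = 1%:M).

Let family (j : index) : 'M[R[i]]_N :=
  match j with inl j => phi (col j P) | inr i => h i end.

Lemma form_col i j : Defs.form B (col i P) (col j P) = (i == j)%:R.
Proof.
have <- : (P^T *m B *m P) i j = (i == j)%:R by rewrite PB mxE.
rewrite /Defs.form tr_col -row_mul mxE [RHS]mxE.
by apply: eq_bigr => a _; rewrite !mxE.
Qed.

Lemma orthonormal_clifford : clifford_family (fun j => phi (col j P)).
Proof.
split=> [i j ij|i].
  apply/eqP; rewrite -addr_eq0 phi_rel form_col.
  by rewrite (negPf ij) mulr0 oppr0 !raddf0.
have := phi_rel (col i P) (col i P); rewrite form_col eqxx mulr1 -mulr2n => e.
have two : 2%:R != 0 :> R[i] by rewrite pnatr_eq0.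
apply: (scalerI two); rewrite scaler_nat e scalerN scalemx1 -raddfN /=.
by rewrite rmorphN rmorph_nat.
Qed.

Lemma basis_expand (x : 'cV[R]_l) : x = \sum_j (invmx P *m x) j 0 *: col j P.
Proof.
rewrite {1}[x](esym (mulKVmx P_unit x)); apply/colP => a; rewrite mxE summxE.
by apply: eq_bigr => b _; rewrite !mxE mulrC.
Qed.

Let family_clifford : clifford_family family.
Proof.
case: Hh => ha h2; case: orthonormal_clifford => pa p2.
split=> [[i|i] [j|j] ij|[i|i]] //=; first exact: pa.
- by rewrite phi_h opprK.
- exact: ha.
Qed.

Let family_irr X : {in all_index, forall i, family i *m X = X *m family i} ->
  exists c, X = c%:M.
Proof.
move=> famX; apply: irr => [x|i]; last exact: (famX (inr i) (in_index _)).
rewrite (basis_expand x) phi_sum mulmx_suml mulmx_sumr; apply: eq_bigr => j _.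
by rewrite -scalemxAl -scalemxAr (famX (inl j) (in_index _)).
Qed.

Let family_w : {in all_index, forall i, w *m family i = - (family i *m w)}.
Proof. by move=> [i|i] _ /=; [exact: w_phi|exact: w_h]. Qed.

Lemma size_all_index : size all_index = (l + k)%N.
Proof. by rewrite size_cat (size_map inl) (size_map inr) !size_enum_ord. Qed.

Lemma vector_module_dim : (N * N = 2 ^ (l + k))%N.
Proof.
rewrite (clifford_module_dim N_gt0 family_clifford index_uniq family_irr w_unit family_w).
by rewrite size_all_index.
Qed.

Variables (g : 'M[R]_l) (V : 'M[R[i]]_l) (d : 'rV[R[i]]_l) (A A' : 'M[R[i]]_N).
Hypotheses (V_unit : V \in unitmx)
  (gV : map_mx (real_complex R) g *m V = V *m diag_mx d)
  (AA' : A *m A' = 1%:M) (A_phi : forall x, A *m phi x = - (phi (g *m x) *m A))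
  (A_h : forall i, A *m h i = h i *m A).

(** Used with [k = 0] for a simple module that splits into two half-spin modules, and with [k = 1]
    for the doubled module in odd dimension. *)
Lemma vector_trace :
  \tr A * \tr A' = (\det (1%:M - g))%:C%C * 2 ^+ k.
Proof.
(* The minus sign in [A_phi] gives an eigenvector of [g] the eigenvalue [- d 0 j] under conjugation
   by [A]; the [h i] have eigenvalue 1, whence the factor [2 ^ k]. *)
pose u (j : index) := match j with inl j => cphi (col j V) | inr i => h i end.
pose mu (j : index) : R[i] := match j with inl j => - d 0 j | inr i => 1 end.
have cphi_A v : A *m cphi v = - (cphi (map_mx (real_complex R) g *m v) *m A).
  have -> : map_mx (real_complex R) g *m v =
      \sum_j v j 0 *: map_mx (real_complex R) (g *m delta_mx j 0).
    rewrite {1}[v]col_sum_delta mulmx_sumr; apply: eq_bigr => j _.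
    by rewrite -scalemxAr map_mxM map_delta_mx.
  rewrite cphi_sum mulmx_sumr mulmx_suml -sumrN; apply: eq_bigr => j _.
  by rewrite cphi_map -scalemxAr A_phi -scalemxAl scalerN.
have h_cphi v i : cphi v *m h i = - (h i *m cphi v).
  rewrite mulmx_suml mulmx_sumr -sumrN; apply: eq_bigr => j _.
  by rewrite -scalemxAl -scalemxAr phi_h scalerN.
have u_rel i j : exists c, u i *m u j + u j *m u i = c%:M.
  case: i j => [i|i] [j|j] /=.
  + exact: cphi_rel.
  + by exists 0; rewrite h_cphi addNr raddf0.
  + by exists 0; rewrite h_cphi addrN raddf0.
  have [->|ij] := eqVneq i j.
    by exists (- 1 - 1); rewrite (proj2 Hh) raddfD /= raddfN.
  by exists 0; rewrite (proj1 Hh) // addNr raddf0.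
have u_span : {in all_index, forall i, exists c : index -> R[i],
    family i = \sum_(j <- all_index) c j *: u j}.
  move=> [i|i] _ /=; last first.
    exists (fun j => (j == inr i)%:R); rewrite (bigD1_seq (inr i)) //= eqxx scale1r.
    by rewrite big1 ?addr0 // => j /negPf ->; rewrite scale0r.
  pose c := invmx V *m map_mx (real_complex R) (col i P).
  exists (fun j => match j with inl j => c j 0 | _ => 0 end).
  rewrite big_cat (big_map inl) (big_map inr) !big_enum /= [X in _ + X]big1 ?addr0 => [|j _]; last first.
    by rewrite scale0r.
  rewrite -cphi_sum -cphi_map; congr cphi.
  rewrite -{1}(mulKVmx V_unit (map_mx _ _)) -/c; apply/colP => a; rewrite mxE summxE.
  by apply: eq_bigr => b _; rewrite !mxE mulrC.
have u_A : {in all_index, forall j, A *m u j = mu j *: (u j *m A)}.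
  move=> [i|i] _ /=; last by rewrite scale1r.
  rewrite cphi_A scaleNr scalemxAl; congr (- (_ *m _)).
  have -> : map_mx (real_complex R) g *m col i V = d 0 i *: col i V.
    rewrite [in LHS]colE mulmxA gV -colE mul_mx_diag; apply/colP => a.
    by rewrite !mxE mulrC.
  have := @cphi_sum _ [:: tt] (fun=> d 0 i) (fun=> col i V).
  by rewrite !big_seq1.
rewrite (clifford_trace_formula N_gt0 family_clifford index_uniq family_irr
  w_unit family_w erefl u_rel u_span AA' u_A).
rewrite big_cat (big_map inl) (big_map inr) !big_enum /=; congr (_ * _); last first.
  by rewrite prodr_const card_ord -[1 + 1]/(2%:R).
rewrite -det_one_sub_diag -(det_one_sub_conj (mulmxV V_unit) gV).
by rewrite -[RHS]det_map_mx map_mxB map_mx1.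
Qed.

End VectorTrace.

(** * Schur's lemma for simple modules over [C(E)] *)

Section CliffordModules.

Variables (R : realType) (l : nat) (B : 'M[R]_l) (Cl : clifford B).

Lemma cmoduleZ n (f : cmodule Cl n) k a : f (k *: a) = (k%:C)%C *: f a.
Proof. exact: (linearZ_LR f). Qed.

Lemma cmodule_scalar n (f : cmodule Cl n) k : f k%:A = ((k%:C)%C)%:M.
Proof. by rewrite (cmoduleZ f) rmorph1 -scalemx1. Qed.

Lemma cmoduleM n (f : cmodule Cl n) a b : f (a * b) = f a *m f b.
Proof. exact: rmorphM. Qed.

Lemma cmodule_gen_linear n (f : cmodule Cl n) k x y :
  f (cl_gen Cl (k *: x + y)) = (k%:C)%C *: f (cl_gen Cl x) + f (cl_gen Cl y).
Proof. by rewrite linearP raddfD; congr (_ + _); exact: cmoduleZ. Qed.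

Lemma cmodule_gen_rel n (f : cmodule Cl n) x y :
  f (cl_gen Cl x) *m f (cl_gen Cl y) + f (cl_gen Cl y) *m f (cl_gen Cl x) =
  ((- (2 * Defs.form B x y))%:C)%C%:M.
Proof. by rewrite -!(cmoduleM f) -raddfD cl_genP; exact: (cmodule_scalar f). Qed.

Lemma cmodule_gen_sqr n (f : cmodule Cl n) x :
  f (cl_gen Cl x) *m f (cl_gen Cl x) = ((- Defs.form B x x)%:C)%C%:M.
Proof.
have two : 2%:R != 0 :> R[i] by rewrite pnatr_eq0.
apply: (scalerI two); rewrite scaler_nat mulr2n (cmodule_gen_rel f) scale_scalar_mx.
by rewrite -mulrN rmorphM rmorph_nat.
Qed.

Lemma cmodule_intertwine n m (f : cmodule Cl n) (g : cmodule Cl m) (Q : 'M_(n, m)) :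
  (forall x, f (cl_gen Cl x) *m Q = Q *m g (cl_gen Cl x)) ->
  forall a, f a *m Q = Q *m g a.
Proof.
move=> fQ; apply: cl_ind => [k|x a IH|a b IHa IHb].
- by rewrite (cmodule_scalar f) (cmodule_scalar g) mul_scalar_mx mul_mx_scalar.
- by rewrite (cmoduleM f) (cmoduleM g) -mulmxA IH !mulmxA fQ.
- by rewrite (rmorphD f) (rmorphD g) mulmxDl mulmxDr IHa IHb.
Qed.

(** A sign on the generators is the twist by [eps], so [Q] intertwines the twisted module with
    [g]. *)
Lemma cmodule_intertwine_sign n m (f : cmodule Cl n) (g : cmodule Cl m)
    (eps : {lrmorphism Cl -> Cl}) (Q : 'M_(n, m)) :
  is_grading_aut eps ->
  (forall x, f (cl_gen Cl x) *m Q = - (Q *m g (cl_gen Cl x))) ->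
  forall a, f (eps a) *m Q = Q *m g a.
Proof.
move=> epsP fQ; apply: cl_ind => [k|x a IH|a b IHa IHb].
- by rewrite linearZ_LR (rmorph1 eps) (cmodule_scalar f) (cmodule_scalar g) mul_scalar_mx mul_mx_scalar.
- have -> : eps (cl_gen Cl x * a) = - (cl_gen Cl x * eps a).
    by rewrite (rmorphM eps) /= (epsP _ _ (cl_graded_gen Cl x)) expr1 mulN1r mulNr.
  have -> : f (- (cl_gen Cl x * eps a)) = - (f (cl_gen Cl x) *m f (eps a)).
    by rewrite (rmorphN f); congr (- _); exact: cmoduleM.
  by rewrite (cmoduleM g) mulNmx -mulmxA IH !mulmxA fQ mulNmx opprK.
- by rewrite (rmorphD eps) (rmorphD f) (rmorphD g) mulmxDl mulmxDr IHa IHb.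
Qed.

Section Simple.

Variables (n : nat) (f : cmodule Cl n).
Hypothesis f_simple : simple_on (fun=> True) f.

Lemma simple_gt0 : (0 < n)%N. Proof. by case: f_simple. Qed.

Lemma simple_stable (U : 'M[R[i]]_n) :
  (forall x, stablemx U (f (cl_gen Cl x))^T) -> U = 0 \/ row_full U.
Proof.
case: f_simple => _ f_irr Ux; apply: f_irr => a _; elim/cl_ind: a => [k|x a IH|a b IHa IHb].
- by rewrite (cmodule_scalar f) tr_scalar_mx mul_mx_scalar scalemx_sub.
- by rewrite (cmoduleM f) trmx_mul stablemxM.
- by rewrite (rmorphD f) raddfD stablemxD.
Qed.

Lemma simple_scalar (X : 'M[R[i]]_n) :
  (forall x, f (cl_gen Cl x) *m X = X *m f (cl_gen Cl x)) -> exists c, X = c%:M.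
Proof.
move=> fX; have [c /eigenvalueP[v /eqP vX v0]] := eigenvalue_closed X^T simple_gt0.
exists c; have [x|U0|Ufull] := simple_stable (U := eigenspace X^T c).
- apply: comm_mx_stable_eigenspace.
  by rewrite /comm_mx -!trmx_mul fX.
- have : (v <= eigenspace X^T c)%MS by apply/eigenspaceP/eqP.
  by rewrite U0 submx0 (negPf v0).
have : (1%:M <= eigenspace X^T c)%MS by rewrite sub1mx.
by move/eigenspaceP; rewrite mul1mx scalemx1 => /(congr1 trmx); rewrite trmxK tr_scalar_mx.
Qed.

End Simple.

(** Image and kernel of [Q] stay submodules when the intertwining holds up to a nonzero scalar;
    [s = -1] covers the twist by the grading. *)
Lemma simple_intertwine_iso n m (f : cmodule Cl n) (g : cmodule Cl m) (Q : 'M_(n, m)) s :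
  simple_on (fun=> True) f -> simple_on (fun=> True) g -> Q != 0 ->
  (forall x, f (cl_gen Cl x) *m Q = s *: (Q *m g (cl_gen Cl x))) -> s != 0 ->
  row_free Q /\ row_full Q.
Proof.
move=> fs gs Q0 fQ s0; split.
  have [x|U0|] := simple_stable fs (U := <<Q^T>>%MS).
  - rewrite (eqmxMr _ (genmxE _)) genmxE -trmx_mul fQ linearZ /= trmx_mul.
    by rewrite scalemx_sub // submxMl.
  - case/eqP: Q0; apply: (can_inj (@trmxK _ _ _)).
    by apply/eqP; rewrite trmx0 -submx0 -U0 genmxE.
  by rewrite /row_full genmxE mxrank_tr.
have [x|K0|Kfull] := simple_stable gs (U := kermx Q^T).
- apply/sub_kermxP; rewrite -mulmxA -trmx_mul.
  have -> : Q *m g (cl_gen Cl x) = s^-1 *: (f (cl_gen Cl x) *m Q).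
    by rewrite fQ scalerA mulVf // scale1r.
  by rewrite linearZ /= trmx_mul -scalemxAr mulmxA mulmx_ker mul0mx scaler0.
- by rewrite /row_full -mxrank_tr -/(row_free _) -kermx_eq0 K0.
case/eqP: Q0; apply: (can_inj (@trmxK _ _ _)); rewrite trmx0.
by rewrite -sub1mx in Kfull; have /sub_kermxP := Kfull; rewrite mul1mx.
Qed.

End CliffordModules.

Section OrderedProduct.

Variables (C : numFieldType) (I : eqType).

Definition ordered_prod n (e : I -> 'M[C]_n) (s : seq I) : 'M[C]_n :=
  foldr (fun i z => e i *m z) 1%:M s.

Lemma ordered_prod_out n (e : I -> 'M[C]_n) s x :
  {in s, forall i, x *m e i = - (e i *m x)} ->
  x *m ordered_prod e s = (-1) ^+ size s *: (ordered_prod e s *m x).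
Proof.
elim: s => [|i s IH] hx; first by rewrite /= mulmx1 mul1mx expr0 scale1r.
rewrite /= mulmxA hx ?mem_head // mulNmx -!mulmxA IH => [|j js]; last first.
  by apply: hx; rewrite in_cons js orbT.
by rewrite -scalemxAr exprS mulN1r scaleNr.
Qed.

(** Of the [size s] exchanges, the one of [e i] with itself costs no sign. Hence the product of an
    odd number of generators commutes with each of them. *)
Lemma ordered_prod_in n (e : I -> 'M[C]_n) s : clifford_family e -> uniq s ->
  {in s, forall i, e i *m ordered_prod e s = - ((-1) ^+ size s *: (ordered_prod e s *m e i))}.
Proof.
case=> ea e2; elim: s => // j s IH /= /andP[js us] i; rewrite in_cons => /predU1P[->|si].
  rewrite -mulmxA (@ordered_prod_out _ e s (e j)) => [|k ks]; last first.
    by apply: ea; apply: contraNneq js => ->.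
  by rewrite -scalemxAr exprS mulN1r scaleNr opprK.
have ij : i != j by apply: contraNneq js => <-.
rewrite mulmxA ea // mulNmx -(mulmxA (e j) (e i)) IH // mulmxN opprK -scalemxAr mulmxA.
by rewrite exprS mulN1r scaleNr opprK.
Qed.

Lemma ordered_prod_unit n (e : I -> 'M[C]_n) s : clifford_family e -> ordered_prod e s \in unitmx.
Proof.
case=> _ e2; elim: s => [|i s IH]; first exact: unitmx1.
rewrite unitmx_mul IH andbT.
suff /mulmx1_unit[] : e i *m (- e i) = 1%:M by [].
by rewrite mulmxN e2 opprK.
Qed.

Lemma ordered_prod_intertwine n m (e : I -> 'M[C]_n) (e' : I -> 'M[C]_m) s Q :
  {in s, forall i, e i *m Q = Q *m e' i} -> ordered_prod e s *m Q = Q *m ordered_prod e' s.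
Proof.
elim: s => [|i s IH] eQ; first by rewrite mul1mx mulmx1.
rewrite /= -mulmxA IH => [|j js]; last by apply: eQ; rewrite in_cons js orbT.
by rewrite !mulmxA eQ ?mem_head.
Qed.

End OrderedProduct.

(** * Spin characters *)

Section SpinTraces.

Variables (R : realType) (l : nat) (B : 'M[R]_l) (Cl : clifford B).
Hypotheses (Bs : forall x y, Defs.form B x y = Defs.form B y x)
  (Bp : forall x, x != 0 -> 0 < Defs.form B x x).

Lemma form_orthonormal_basis :
  exists2 P : 'M[R]_l, P \in unitmx & P^T *m B *m P = 1%:M.
Proof.
apply: orthonormal_basis => [|x /Bp //].
apply/matrixP => i j; rewrite mxE.
have formE a b : Defs.form B (delta_mx a 0) (delta_mx b 0) = B a b.
  by rewrite /Defs.form trmx_delta -rowE -colE !mxE.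
by rewrite -!formE.
Qed.

(** A vector mapped to 0 would have norm 0 by the Clifford relation. *)
Lemma cl_gen_inj : injective (cl_gen Cl).
Proof.
move=> x y /eqP; rewrite -subr_eq0 -linearB /= => /eqP xy0.
apply/eqP; rewrite -subr_eq0; apply: contraT => /Bp.
have := cl_genP Cl (x - y) (x - y); rewrite xy0 mul0r addr0 => /esym/eqP.
rewrite scaler_eq0 oner_eq0 orbF oppr_eq0 mulf_eq0 pnatr_eq0 /= => /eqP ->.
by rewrite ltxx.
Qed.

Lemma cmodule_gen_unit n (f : cmodule Cl n) x : x != 0 -> f (cl_gen Cl x) \in unitmx.
Proof.
move=> /Bp Bx; have b0 : ((- Defs.form B x x)%:C)%C != 0 :> R[i].
  by rewrite fmorph_eq0 oppr_eq0 gt_eqF.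
suff /mulmx1_unit[] : f (cl_gen Cl x) *m
    (((- Defs.form B x x)%:C)%C^-1 *: f (cl_gen Cl x)) = 1%:M by [].
by rewrite -scalemxAr (cmodule_gen_sqr f) scale_scalar_mx mulVf.
Qed.

(* For x != 0, om + f(x) om f(x)^-1 commutes with C(E), hence is a scalar c;
   as om and its conjugate are involutions, c != 0 would make om a scalar. *)
Lemma even_commutant_gen n (f : cmodule Cl n) (om : 'M[R[i]]_n) x :
  simple_on (fun=> True) f -> om *m om = 1%:M -> (forall c, om <> c%:M) ->
  (forall a : Cl, cl_graded false a -> om *m f a = f a *m om) ->
  om *m f (cl_gen Cl x) = - (f (cl_gen Cl x) *m om).
Proof.
move=> f_simple om2 om_ns om_even.
have [->|x0] := eqVneq x 0.
  by rewrite linear0 raddf0 mulmx0 mul0mx oppr0.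
have fx_unit := cmodule_gen_unit f x0.
set X := f (cl_gen Cl x) in fx_unit *.
pose om1 := X *m om *m invmx X.
have omXY y : om *m (X *m f (cl_gen Cl y)) = X *m f (cl_gen Cl y) *m om.
  rewrite -(cmoduleM f); apply: om_even.
  exact: cl_gradedM (cl_graded_gen Cl x) (cl_graded_gen Cl y).
have omYX y : om *m (f (cl_gen Cl y) *m X) = f (cl_gen Cl y) *m X *m om.
  rewrite -(cmoduleM f); apply: om_even.
  exact: cl_gradedM (cl_graded_gen Cl y) (cl_graded_gen Cl x).
have [b XX] : exists b, X *m X = b%:M by exists ((- Defs.form B x x)%:C)%C; exact: cmodule_gen_sqr.
have b0 : b != 0.
  apply/eqP => b0; move: XX; rewrite b0 raddf0 => XX.
  have := mulKmx fx_unit X; rewrite XX mulmx0 => X0.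
  apply: (om_ns 0).
  by rewrite -[om]mulmx1 -(mulmxV fx_unit) -X0 mul0mx mulmx0 raddf0.
have invX : invmx X = b^-1 *: X.
  apply: (canRL (scalerK b0)); rewrite -mul_scalar_mx -XX.
  by rewrite -mulmxA mulmxV // mulmx1.
have [|c omc] := simple_scalar f_simple (X := om + om1).
  move=> y; rewrite mulmxDr mulmxDl addrC; congr (_ + _).
    rewrite /om1 !mulmxA -omYX -!mulmxA mulmxV //.
    by rewrite mulmx1.
  rewrite /om1 invX -!scalemxAr -!scalemxAl -!mulmxA omXY.
  by rewrite !mulmxA XX -mulmxA mul_scalar_mx scalerK.
have om1E : om1 = c%:M - om by rewrite -omc addrC addKr.
have om1_sqr : om1 *m om1 = 1%:M.
  by rewrite /om1 !mulmxA mulmxKV // -(mulmxA X) om2 mulmx1 mulmxV.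
have c0 : c = 0.
  apply/eqP/negPn/negP => c_neq0.
  have e1 : om *m om1 = c *: om - 1%:M.
    by rewrite om1E mulmxBr om2 mul_mx_scalar.
  have e2 : om1 *m om1 = c *: om1 - om *m om1.
    by rewrite {1}om1E mulmxBl mul_scalar_mx.
  move: e2; rewrite om1_sqr e1 opprB addrCA -[LHS]addr0 => /addrI/esym/eqP.
  rewrite subr_eq0 => /eqP/(scalerI c_neq0) om1om; move: omc; rewrite om1om => omc.
  have two : 2%:R != 0 :> R[i] by rewrite pnatr_eq0.
  apply: (om_ns (2%:R^-1 * c)); rewrite -scale_scalar_mx -omc.
  by rewrite -mulr2n -(scaler_nat 2 om) scalerA mulVf // scale1r.
have : X *m om *m invmx X = - om by rewrite -/om1 om1E c0 raddf0 sub0r.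
by move/(congr1 (mulmx^~ X)); rewrite mulmxKV // mulNmx => ->; rewrite opprK.
Qed.

Section Even.

Variables (n1 n2 : nat) (f : cmodule Cl (n1 + n2)).
Variables (fp : Cl -> 'M[R[i]]_n1) (fm : Cl -> 'M[R[i]]_n2) (P : 'M[R[i]]_(n1 + n2)).
Hypotheses (n1_gt0 : (0 < n1)%N) (n2_gt0 : (0 < n2)%N)
  (f_simple : simple_on (fun=> True) f) (P_unit : P \in unitmx)
  (fP : forall a : Cl, cl_graded false a ->
     f a *m P = P *m block_mx (fp a) 0 0 (fm a)).

(** Built from the given decomposition, so that its trace against even elements is the difference of
    the spin characters by construction; anticommutation with [E] is then the point to prove. *)
Definition parity_mx : 'M[R[i]]_(n1 + n2) :=
  P *m block_mx 1%:M 0 0 (- 1%:M) *m invmx P.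
Local Notation om := parity_mx.

Lemma parity_mx_sqr : om *m om = 1%:M.
Proof.
rewrite /om !mulmxA mulmxKV // -(mulmxA P) mulmx_block.
rewrite !(mulmx0, mul0mx, mul1mx, addr0, add0r) mulmxN mulmx1 opprK.
by rewrite -scalar_mx_block mulmx1 mulmxV.
Qed.

Lemma parity_mx_unit : om \in unitmx.
Proof. by have [] := mulmx1_unit parity_mx_sqr. Qed.

Lemma parity_mx_not_scalar c : om <> c%:M.
Proof.
move/(congr1 (fun X => invmx P *m X *m P)).
rewrite /om !mulmxA mulVmx // mul1mx mulmxKV // mul_mx_scalar -scalemxAl mulVmx //.
rewrite scalemx1 scalar_mx_block => /eq_block_mx[e1 _ _ e2].
have := congr1 (fun X : 'M_n1 => X (Ordinal n1_gt0) (Ordinal n1_gt0)) e1.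
have := congr1 (fun X : 'M_n2 => X (Ordinal n2_gt0) (Ordinal n2_gt0)) e2.
rewrite !mxE !eqxx !mulr1n => <- /eqP.
by rewrite -subr_eq0 opprK -(natrD _ 1 1) pnatr_eq0.
Qed.

Lemma parity_mx_even a : cl_graded false a -> om *m f a = f a *m om.
Proof.
move=> /fP fa; have -> : f a = P *m block_mx (fp a) 0 0 (fm a) *m invmx P.
  by rewrite -fa mulmxK.
rewrite /om !mulmxA !(mulmxKV P_unit) -!(mulmxA P) !mulmx_block.
by rewrite !(mulmx0, mul0mx, mul1mx, mulmx1, addr0, add0r) mulmxN mulNmx mul1mx mulmx1.
Qed.

Lemma mxtrace_parity a : cl_graded false a -> \tr (f a *m om) = \tr (fp a) - \tr (fm a).
Proof.
move=> /fP fa; rewrite /om !mulmxA fa mxtrace_mulC !mulmxA mulVmx // mul1mx.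
rewrite mulmx_block !(mulmx0, mul0mx, mulmx1, addr0, add0r) mulmxN mulmx1.
by rewrite mxtrace_block raddfN.
Qed.

Lemma parity_mx_gen x : om *m f (cl_gen Cl x) = - (f (cl_gen Cl x) *m om).
Proof.
apply: even_commutant_gen => //; first exact: parity_mx_sqr.
  exact: parity_mx_not_scalar.
exact: parity_mx_even.
Qed.

Let h (i : 'I_0) : 'M[R[i]]_(n1 + n2) := 0.
Let h_clifford : clifford_family h. Proof. by split=> [] []. Qed.
Let phi_h x i : f (cl_gen Cl x) *m h i = - (h i *m f (cl_gen Cl x)).
Proof. by case: i. Qed.
Let phi_irr X : (forall x, f (cl_gen Cl x) *m X = X *m f (cl_gen Cl x)) ->
  (forall i, h i *m X = X *m h i) -> exists c, X = c%:M.
Proof. by move=> fX _; exact: simple_scalar f_simple _ fX. Qed.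
Let om_h i : om *m h i = - (h i *m om). Proof. by case: i. Qed.

Lemma parity_dim : ((n1 + n2) * (n1 + n2) = 2 ^ l)%N.
Proof.
have [P0 P0_unit P0B] := form_orthonormal_basis.
rewrite (vector_module_dim (simple_gt0 f_simple) (cmodule_gen_linear f)
  (cmodule_gen_rel f) h_clifford phi_h phi_irr parity_mx_unit parity_mx_gen om_h
  P0_unit P0B).
by rewrite addn0.
Qed.

Variables (g : 'M[R]_l) (V : 'M[R[i]]_l) (d : 'rV[R[i]]_l).
Hypotheses (V_unit : V \in unitmx)
  (gV : map_mx (real_complex R) g *m V = V *m diag_mx d).

Lemma parity_trace A A' : A *m A' = 1%:M ->
  (forall x, A *m f (cl_gen Cl x) = - (f (cl_gen Cl (g *m x)) *m A)) ->
  \tr A * \tr A' = (\det (1%:M - g))%:C%C.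
Proof.
move=> AA' Af; have [P0 P0_unit P0B] := form_orthonormal_basis.
have Ah i : A *m h i = h i *m A by case: i.
rewrite (vector_trace (simple_gt0 f_simple) (cmodule_gen_linear f)
  (cmodule_gen_rel f) h_clifford phi_h phi_irr parity_mx_unit parity_mx_gen om_h
  P0_unit P0B V_unit gV AA' Af Ah).
by rewrite mulr1.
Qed.

Lemma even_spin_trace a a' : cl_graded false a -> cl_graded false a' -> a * a' = 1 ->
  (forall x, a * cl_gen Cl x = cl_gen Cl (g *m x) * a) ->
  (\tr (fp a) - \tr (fm a)) * (\tr (fp a') - \tr (fm a')) = (\det (1%:M - g))%:C%C.
Proof.
move=> ha ha' aa' ag; rewrite -(mxtrace_parity ha) -(mxtrace_parity ha').
(* Cyclicity puts the second factor in the form [om *m f a'], the inverse of [f a *m om]. *)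
rewrite [X in _ * X]mxtrace_mulC; apply: parity_trace => [|x].
  rewrite (mulmxA (f a *m om)) -(mulmxA (f a) om om) parity_mx_sqr mulmx1.
  by rewrite -(cmoduleM f) aa' (rmorph1 f).
rewrite -(mulmxA (f a) om) parity_mx_gen mulmxN (mulmxA (f a)) -(cmoduleM f) ag.
by rewrite (cmoduleM f) -mulmxA.
Qed.

(** Here [f a] carries the sign required by [parity_trace] without a factor [om], and its trace is 0
    because it anticommutes with [om]. *)
Lemma odd_element_trace a a' : a * a' = 1 ->
  (forall x, a * cl_gen Cl x = - (cl_gen Cl (g *m x) * a)) ->
  om *m f a = - (f a *m om) -> (\det (1%:M - g))%:C%C = 0 :> R[i].
Proof.
move=> aa' ag oma; rewrite -(@parity_trace (f a) (f a')) => [||x].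
- by rewrite (mxtrace_anticomm parity_mx_unit oma) mul0r.
- by rewrite -(cmoduleM f) aa' (rmorph1 f).
rewrite -(cmoduleM f) ag (rmorphN f); congr (- _); exact: cmoduleM.
Qed.

Variables (eps : {lrmorphism Cl -> Cl}) (epsP : is_grading_aut eps).

Lemma parity_mx_odd a : cl_graded true a -> om *m f a = - (f a *m om).
Proof.
move=> ha; have fom x : f (cl_gen Cl x) *m om = - (om *m f (cl_gen Cl x)).
  by rewrite parity_mx_gen opprK.
rewrite -(cmodule_intertwine_sign epsP fom) (epsP ha) expr1 mulN1r (rmorphN f).
by rewrite mulNmx.
Qed.

(* If om f(a) is a scalar c, then both om f(a) = c and f(a) om = c, whereas om
   and f(a) anticommute. *)
Lemma no_odd_twisted_central a a' : cl_graded true a -> a * a' = 1 ->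
  ~ (forall x, a * cl_gen Cl x = - (cl_gen Cl x * a)).
Proof.
move=> ha aa' ax; have oma := parity_mx_odd ha.
have [|c omac] := simple_scalar f_simple (X := om *m f a).
  move=> x; have fax : f a *m f (cl_gen Cl x) = - (f (cl_gen Cl x) *m f a).
    by rewrite -(cmoduleM f) ax (rmorphN f); congr (- _); exact: cmoduleM.
  rewrite -(mulmxA om (f a)) fax mulmxN (mulmxA om (f _)) parity_mx_gen mulNmx opprK.
  by rewrite (mulmxA (f _) om).
have fac : f a = c *: om.
  by rewrite -[f a]mul1mx -parity_mx_sqr -(mulmxA om om) omac mul_mx_scalar.
have /eqP : c%:M = - c%:M :> 'M[R[i]]_(n1 + n2).
  by rewrite -{1}omac oma {1}fac -scalemxAl parity_mx_sqr scalemx1.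
rewrite -addr_eq0 -mulr2n -(scaler_nat 2 c%:M) scaler_eq0 pnatr_eq0 /= => /eqP c0.
have fa0 : f a = 0 by rewrite fac -mul_scalar_mx c0 mul0mx.
have one0 : (1%:M : 'M[R[i]]_(n1 + n2)) = 0.
  have faa' : f (a * a') = 1%:M by rewrite aa'; exact: rmorph1.
  by rewrite -faa' (cmoduleM f) fa0 mul0mx.
by apply: (@parity_mx_not_scalar 0); rewrite -[om]mulmx1 one0 mulmx0 raddf0.
Qed.

End Even.

(** * Spin modules in odd dimension *)

Section Odd.

Hypothesis l_odd : odd l.

Variables (P : 'M[R]_l).
Hypotheses (P_unit : P \in unitmx) (PB : P^T *m B *m P = 1%:M).

Let e n (f : cmodule Cl n) (j : 'I_l) := f (cl_gen Cl (col j P)).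

Let e_clifford n (f : cmodule Cl n) : clifford_family (e f).
Proof. exact: orthonormal_clifford (cmodule_gen_rel f) _ PB. Qed.

Lemma cmodule_basis_intertwine n m (f : cmodule Cl n) (g : cmodule Cl m) Q s :
  (forall j, e f j *m Q = s *: (Q *m e g j)) ->
  forall x, f (cl_gen Cl x) *m Q = s *: (Q *m g (cl_gen Cl x)).
Proof.
move=> eQ x; rewrite (basis_expand P_unit x) linear_sum.
rewrite (raddf_sum f) (raddf_sum g) mulmx_suml mulmx_sumr scaler_sumr.
apply: eq_bigr => j _; rewrite linearZ /=.
have -> : f ((invmx P *m x) j 0 *: cl_gen Cl (col j P)) =
  (((invmx P *m x) j 0)%:C)%C *: e f j by exact: cmoduleZ.
have -> : g ((invmx P *m x) j 0 *: cl_gen Cl (col j P)) =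
  (((invmx P *m x) j 0)%:C)%C *: e g j by exact: cmoduleZ.
by rewrite -scalemxAl eQ -scalemxAr !scalerA mulrC.
Qed.

Let zf n (f : cmodule Cl n) := ordered_prod (e f) (enum 'I_l).

Lemma odd_ordered_prod_scalar n (f : cmodule Cl n) : simple_on (fun=> True) f ->
  exists2 c, c != 0 & ordered_prod (e f) (enum 'I_l) = c%:M.
Proof.
move=> fs; have [|c zc] := simple_scalar fs (X := zf f).
  move=> x; rewrite -[RHS]scale1r; apply: cmodule_basis_intertwine => j.
  rewrite /zf ordered_prod_in ?enum_uniq ?mem_enum // size_enum_ord -signr_odd l_odd.
  by rewrite expr1 scaleN1r opprK scale1r.
exists c => //; apply/eqP => c0; have := ordered_prod_unit (enum 'I_l) (e_clifford f).
rewrite -/(zf f) zc c0 raddf0 => u; have n0 := simple_gt0 fs.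
have := congr1 (fun X : 'M_n => X (Ordinal n0) (Ordinal n0)) (mulVmx u).
by rewrite mulmx0 !mxE eqxx => /eqP; rewrite eq_sym oner_eq0.
Qed.

(** Passing [Y] through the volume element costs an odd number of signs, yet that element is a
    nonzero scalar. *)
Lemma odd_anticomm n (f : cmodule Cl n) Y : simple_on (fun=> True) f ->
  (forall x, Y *m f (cl_gen Cl x) = - (f (cl_gen Cl x) *m Y)) -> Y = 0.
Proof.
move=> fs Yf; have [c c0 zc] := odd_ordered_prod_scalar fs.
have := @ordered_prod_out _ _ _ (e f) (enum 'I_l) Y (fun j _ => Yf _).
rewrite zc size_enum_ord -signr_odd l_odd expr1 mul_mx_scalar mul_scalar_mx.
rewrite scaleN1r => /eqP; rewrite -addr_eq0 -mulr2n -(scaler_nat 2 (c *: Y)).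
by rewrite scaler_eq0 pnatr_eq0 scaler_eq0 (negPf c0) => /eqP.
Qed.

(* All but one vector of an orthonormal basis generate an algebra acting
   irreducibly on both modules, and an average over cliff_prods produces a
   nonzero intertwiner Q for it. The last vector is then intertwined up to a
   sign, which is -1 since the modules are not isomorphic; multiplying Q by the
   product of the other vectors reverses the remaining signs. *)
Lemma odd_sign_intertwiner n m (f : cmodule Cl n) (g : cmodule Cl m) :
  simple_on (fun=> True) f -> simple_on (fun=> True) g -> ~ cmodule_iso f g ->
  exists Q : 'M[R[i]]_(n, m), [/\ row_free Q, row_full Q
    & forall x, f (cl_gen Cl x) *m Q = - (Q *m g (cl_gen Cl x))].
Proof.
move=> fs gs fg.
have [cf cf0] := odd_ordered_prod_scalar fs; have [cg cg0] := odd_ordered_prod_scalar gs.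
have [i0 [s es]] : exists i s, enum 'I_l = i :: s.
  case: (enum 'I_l) (size_enum_ord l) => [l0|i s _]; last by exists i, s.
  by move: l_odd; rewrite -l0.
have us : uniq (i0 :: s) by rewrite -es enum_uniq.
have /andP[i0s us'] := us.
have szs : ~~ odd (size s).
  by have := size_enum_ord l; rewrite es /= => szl; move: l_odd; rewrite -{1}szl.
rewrite es /= => zg zf'.
have [ea e2] := e_clifford f; have [ea' e2'] := e_clifford g.
(* The omitted vector, times i, is an involution anticommuting with the remaining ones, as
   [trace_cliff_prods] requires. *)
pose om := 'i%C *: e f i0.
have om_unit : om \in unitmx.
  suff /mulmx1_unit[] : om *m om = 1%:M by [].
  by rewrite -scalemxAl -scalemxAr scalerA e2 -expr2 sqr_i scaleN1r opprK.
have om_e : {in s, forall j, om *m e f j = - (e f j *m om)}.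
  move=> j js; rewrite -scalemxAl -scalemxAr ea ?scalerN //.
  by apply: contraNneq i0s => ->.
have tr_ne : \sum_a \sum_b cliff_avg (e f) (e g) s (delta_mx a b) a b != 0.
  rewrite -trace_cliff_avg (trace_cliff_prods _ (e_clifford f) om_unit om_e).
    by rewrite mulf_neq0 // pnatr_eq0 -lt0n ?(simple_gt0 fs) ?(simple_gt0 gs).
  exact: us'.
have [X X0] : exists X, cliff_avg (e f) (e g) s X != 0.
  apply: contrapT => noX; case/eqP: tr_ne; rewrite big1 // => a _.
  rewrite big1 // => b _; have [->|nz] := eqVneq (cliff_avg (e f) (e g) s (delta_mx a b)) 0.
    by rewrite mxE.
  by case: noX; exists (delta_mx a b).
set Q := cliff_avg _ _ _ _ in X0.
have eQ : {in s, forall j, e f j *m Q = Q *m e g j}.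
  by apply: cliff_avg_intertwine (e_clifford f) (e_clifford g) _ _ us'.
have zQ := ordered_prod_intertwine eQ.
(* Both volume elements are scalars, so the omitted vector is determined by the others, and [Q]
   intertwines it up to the ratio of these scalars. *)
pose k := cf / cg.
have zg_unit := ordered_prod_unit s (e_clifford g).
have e0Q : e f i0 *m Q = k *: (Q *m e g i0).
  apply: (can_inj (mulmxK zg_unit)); rewrite -mulmxA -zQ mulmxA zf' mul_scalar_mx.
  by rewrite -scalemxAl -mulmxA zg mul_mx_scalar scalerA divfK.
have k2 : k ^+ 2 = 1.
  have : e f i0 *m (e f i0 *m Q) = - (k ^+ 2 *: Q).
    by rewrite e0Q -scalemxAr mulmxA e0Q -scalemxAl -mulmxA e2' scalerA mulmxN mulmx1 scalerN.
  rewrite mulmxA e2 mulNmx mul1mx => /oppr_inj/eqP.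
  rewrite -subr_eq0 -{1}[Q]scale1r -scalerBl scaler_eq0 (negPf X0) orbF subr_eq0.
  by move/eqP.
have in_s j : j = i0 \/ j \in s.
  by have := mem_enum 'I_l j; rewrite es in_cons => /predU1P.
have iso_of Q' c : Q' != 0 -> c != 0 -> (forall j, e f j *m Q' = c *: (Q' *m e g j)) ->
    [/\ row_free Q', row_full Q'
      & forall x, f (cl_gen Cl x) *m Q' = c *: (Q' *m g (cl_gen Cl x))].
  move=> Q'0 c0 /cmodule_basis_intertwine fQ.
  by have [] := simple_intertwine_iso fs gs Q'0 fQ c0.
have /orP[/eqP k1|/eqP kN1] : (k == 1) || (k == - 1) by rewrite -sqrf_eq1 k2.
  have e1Q j : e f j *m Q = 1 *: (Q *m e g j).
    by rewrite scale1r; case: (in_s j) => [->|/eQ]; rewrite ?e0Q ?k1 ?scale1r.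
  have [Qfree Qfull fQ] := iso_of Q 1 X0 (oner_neq0 _) e1Q.
  case: fg; exists Q; split; [exact: Qfree|exact: Qfull|].
  apply: cmodule_intertwine => x.
  by rewrite fQ scale1r.
have [|||Qfree Qfull fQ] := iso_of (Q *m ordered_prod (e g) s) (-1).
- apply: contraNneq X0 => Qz; apply/eqP.
  by rewrite -(mulmxK zg_unit Q) Qz mul0mx.
- by rewrite oppr_eq0 oner_eq0.
- move=> j; case: (in_s j) => [->|js].
    rewrite mulmxA e0Q kN1 -scalemxAl -!mulmxA; congr (_ *: (_ *m _)).
    rewrite (@ordered_prod_out _ _ _ (e g) s (e g i0)) => [|j' js].
      by rewrite -signr_odd (negPf szs) expr0 scale1r.
    by apply: ea'; apply: contraNneq i0s => ->.
  rewrite mulmxA (eQ _ js) -!mulmxA (ordered_prod_in (e_clifford g) us' js).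
  by rewrite -signr_odd (negPf szs) expr0 scale1r mulmxN scaleN1r.
by exists (Q *m ordered_prod (e g) s); split=> // x; rewrite fQ scaleN1r.
Qed.

Section Doubling.

Variables (n : nat) (f : cmodule Cl n).
Hypothesis f_simple : simple_on (fun=> True) f.

(* The module f + (f o eps) of C(E), extended to the Clifford algebra of the
   sum of E and a line, acting by exchanging the two summands. *)
Let phi2 (x : 'cV[R]_l) : 'M[R[i]]_(n + n) :=
  block_mx (f (cl_gen Cl x)) 0 0 (- f (cl_gen Cl x)).
Let h2 (i : 'I_1) : 'M[R[i]]_(n + n) := block_mx 0 1%:M (- 1%:M) 0.
Let om2 : 'M[R[i]]_(n + n) := block_mx 0 1%:M 1%:M 0.

Local Notation block0 :=
  (mulmx0, mul0mx, mul1mx, mulmx1, addr0, add0r, mulmxN, mulNmx, opprK) (only parsing).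

Let phi2P k x y : phi2 (k *: x + y) = (k%:C)%C *: phi2 x + phi2 y.
Proof.
by rewrite /phi2 (cmodule_gen_linear f) scale_block_mx add_block_mx !scaler0 !addr0 scalerN opprD.
Qed.

Let phi2_rel x y : phi2 x *m phi2 y + phi2 y *m phi2 x =
  ((- (2 * Defs.form B x y))%:C)%C%:M.
Proof.
by rewrite /phi2 !mulmx_block !block0 add_block_mx !addr0 (cmodule_gen_rel f) -scalar_mx_block.
Qed.

Let h2_clifford : clifford_family h2.
Proof.
split=> [i j|i]; first by rewrite !ord1 eqxx.
by rewrite mulmx_block !block0 scalar_mx_block opp_block_mx oppr0.
Qed.

Let phi2_h x i : phi2 x *m h2 i = - (h2 i *m phi2 x).
Proof. by rewrite /phi2 /h2 !mulmx_block !block0 opp_block_mx oppr0 opprK. Qed.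

Let om2_unit : om2 \in unitmx.
Proof.
suff /mulmx1_unit[] : om2 *m om2 = 1%:M by [].
by rewrite mulmx_block !block0 -scalar_mx_block.
Qed.

Let om2_phi x : om2 *m phi2 x = - (phi2 x *m om2).
Proof. by rewrite /phi2 /om2 !mulmx_block !block0 opp_block_mx oppr0 opprK. Qed.

Let om2_h i : om2 *m h2 i = - (h2 i *m om2).
Proof. by rewrite /om2 /h2 !mulmx_block !block0 opp_block_mx oppr0 opprK. Qed.

(** Off-diagonal blocks anticommute with [E] under [f], hence vanish; the first diagonal block is
    scalar by Schur, and the root [h2] equates the two. *)
Let phi2_irr X : (forall x, phi2 x *m X = X *m phi2 x) ->
  (forall i, h2 i *m X = X *m h2 i) -> exists c, X = c%:M.
Proof.
rewrite -[X]submxK; set X11 := ulsubmx X; set X12 := ursubmx X.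
set X21 := dlsubmx X; set X22 := drsubmx X => phiX /(_ 0).
rewrite !mulmx_block !block0 => /eq_block_mx[_ e22 _ _].
have X12_0 : X12 = 0.
  apply: (odd_anticomm f_simple) => x; have := phiX x.
  by rewrite !mulmx_block !block0 => /eq_block_mx[_ -> _ _]; rewrite opprK.
have X21_0 : X21 = 0.
  apply: (odd_anticomm f_simple) => x; have := phiX x.
  by rewrite !mulmx_block !block0 => /eq_block_mx[_ _ <- _].
have [|c cE] := simple_scalar f_simple (X := X11).
  by move=> x; have := phiX x; rewrite !mulmx_block !block0 => /eq_block_mx[].
by exists c; rewrite X12_0 X21_0 e22 cE -scalar_mx_block.
Qed.

Variables (g : 'M[R]_l) (V : 'M[R[i]]_l) (d : 'rV[R[i]]_l).
Hypotheses (V_unit : V \in unitmx)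
  (gV : map_mx (real_complex R) g *m V = V *m diag_mx d).

Let doubled_trace A A' : A *m A' = 1%:M ->
  (forall x, A *m phi2 x = - (phi2 (g *m x) *m A)) ->
  (forall i, A *m h2 i = h2 i *m A) ->
  \tr A * \tr A' = (\det (1%:M - g))%:C%C * 2.
Proof.
have N_gt0 : (0 < n + n)%N by rewrite addn_gt0 (simple_gt0 f_simple).
move=> AA' Aphi Ah.
by rewrite (vector_trace N_gt0 phi2P phi2_rel h2_clifford phi2_h phi2_irr om2_unit
  om2_phi om2_h P_unit PB V_unit gV AA' Aphi Ah) expr1.
Qed.

Lemma odd_trace_neg D D' : D *m D' = 1%:M ->
  (forall x, D *m f (cl_gen Cl x) = - (f (cl_gen Cl (g *m x)) *m D)) ->
  (2 * \tr D) * (2 * \tr D') = (\det (1%:M - g))%:C%C * 2.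
Proof.
move=> DD' Df; rewrite -(doubled_trace (A := block_mx D 0 0 D) (A' := block_mx D' 0 0 D')).
- by rewrite !mxtrace_block -!mulr2n !mulr_natl.
- by rewrite mulmx_block !block0 DD' -scalar_mx_block.
- by move=> x; rewrite /phi2 !mulmx_block !block0 opp_block_mx oppr0 Df opprK.
by move=> i; rewrite !mulmx_block !block0.
Qed.

(** Without a sign in the hypothesis, the sign needed for the doubled module is supplied by
    exchanging the summands; that matrix has zero diagonal blocks, hence trace 0. *)
Lemma odd_trace_pos D D' : D *m D' = 1%:M ->
  (forall x, D *m f (cl_gen Cl x) = f (cl_gen Cl (g *m x)) *m D) ->
  (\det (1%:M - g))%:C%C = 0 :> R[i].
Proof.
move=> DD' Df; have two : 2 != 0 :> R[i] by rewrite pnatr_eq0.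
apply: (mulIf two); rewrite mul0r.
rewrite -(doubled_trace (A := block_mx 0 D (- D) 0) (A' := block_mx 0 (- D') D' 0)).
- by rewrite !mxtrace_block !raddf0 addr0 mul0r.
- by rewrite mulmx_block !block0 DD' -scalar_mx_block.
- by move=> x; rewrite /phi2 !mulmx_block !block0 opp_block_mx oppr0 Df.
by move=> i; rewrite !mulmx_block !block0.
Qed.

End Doubling.

Lemma grading_autK (eps : {lrmorphism Cl -> Cl}) : is_grading_aut eps ->
  forall a, eps (eps a) = a.
Proof.
move=> epsP a; have [a0 [a1 [h0 h1 ->]]] := cl_generatedP a.
have e0 := epsP _ _ h0; have e1 := epsP _ _ h1; rewrite expr0 mul1r in e0.
rewrite expr1 mulN1r in e1.
have -> : eps (a0 + a1) = a0 - a1 by rewrite raddfD /= e0 e1.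
by rewrite raddfB /= e0 e1 opprK.
Qed.

Lemma odd_spin_trace n m (f : cmodule Cl n) (f' : cmodule Cl m)
    (eps : {lrmorphism Cl -> Cl}) (g : 'M[R]_l) (V : 'M[R[i]]_l) d (a a' : Cl) :
  simple_on (fun=> True) f -> simple_on (fun=> True) f' -> ~ cmodule_iso f f' ->
  is_grading_aut eps -> V \in unitmx ->
  map_mx (real_complex R) g *m V = V *m diag_mx d ->
  a * a' = 1 -> a' * a = 1 ->
  (forall x, eps a * cl_gen Cl x = cl_gen Cl (g *m x) * a) ->
  (\tr (f a) - \tr (f' a)) * (\tr (f a') - \tr (f' a')) =
  (\det (1%:M - g))%:C%C * 2.
Proof.
move=> fs fs' ff' epsP V_unit gV aa' a'a ag.
have [Q [Qfree Qfull fQ]] := odd_sign_intertwiner fs fs' ff'.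
have trE b : \tr (f' b) = \tr (f (eps b)).
  have := cmodule_intertwine_sign epsP fQ b.
  move/(congr1 (mulmx^~ (pinvmx Q))); rewrite -mulmxA mulmxVp // mulmx1 => ->.
  by rewrite mxtrace_mulC mulmxA mulVpmx // mul1mx.
rewrite !trE; set D := f a; set E := f a'; set D1 := f (eps a); set E1 := f (eps a').
have DE : D *m E = 1%:M by rewrite -(cmoduleM f) aa' (rmorph1 f).
have ED : E *m D = 1%:M by rewrite -(cmoduleM f) a'a (rmorph1 f).
have D1E1 : D1 *m E1 = 1%:M by rewrite -(cmoduleM f) -(rmorphM eps) aa' (rmorph1 eps) (rmorph1 f).
have E1D1 : E1 *m D1 = 1%:M by rewrite -(cmoduleM f) -(rmorphM eps) a'a (rmorph1 eps) (rmorph1 f).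
pose F x := f (cl_gen Cl x).
have D1F x : D1 *m F x = F (g *m x) *m D by rewrite -!(cmoduleM f) ag.
have DF x : D *m F x = F (g *m x) *m D1.
  rewrite -!(cmoduleM f); congr (f _); have := congr1 eps (ag x).
  rewrite !rmorphM /= (grading_autK epsP) !(epsP _ _ (cl_graded_gen Cl _)) expr1 !mulN1r.
  by rewrite mulrN mulNr => /oppr_inj.
have FE1 x : F x *m E1 = E *m F (g *m x).
  by rewrite -[F x]mul1mx -ED -(mulmxA E) DF -!mulmxA D1E1 mulmx1.
have FE x : F x *m E = E1 *m F (g *m x).
  by rewrite -[F x]mul1mx -E1D1 -(mulmxA E1) D1F -!mulmxA DE mulmx1.
(* [E] and [E1] represent the inverse of [a] and its [eps]-twist. The two equal products give a
   scalar [c] with [D1 = c *: D]: in the module, [a] behaves as a homogeneous element of parity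
   given by [c = 1] or [c = -1]. *)
have HE : E *m D1 = E1 *m D.
  apply/eqP; rewrite -subr_eq0; apply/eqP/(odd_anticomm fs) => x.
  rewrite mulmxBl mulmxBr opprB -!mulmxA -/(F x) D1F DF.
  by rewrite !mulmxA FE1 FE.
have [|c Hc] := simple_scalar fs (X := E *m D1).
  by move=> x; rewrite -/(F x) {2}HE -!mulmxA DF !mulmxA FE.
have D1D : D1 = c *: D by rewrite -[D1]mul1mx -DE -mulmxA Hc mul_mx_scalar.
have E1E : E1 = c *: E by rewrite -[E1]mulmx1 -DE mulmxA -HE Hc mul_scalar_mx.
have c2 : c ^+ 2 = 1.
  have n0 := simple_gt0 fs.
  have := congr1 (fun X : 'M_n => X (Ordinal n0) (Ordinal n0)) D1E1.
  rewrite D1D E1E -scalemxAl -scalemxAr DE scalerA -expr2 scalemx1 !mxE eqxx.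
  by rewrite !mulr1n.
(* For [c = 1] the two characters agree and the determinant vanishes; for [c = -1] their difference
   is twice the trace of [D]. *)
have /orP[/eqP c1|/eqP c1] : (c == 1) || (c == - 1) by rewrite -sqrf_eq1 c2.
  rewrite D1D E1E c1 !scale1r !subrr mul0r.
  rewrite (odd_trace_pos fs V_unit gV DE) ?mul0r // => x.
  by rewrite -/(F x) DF D1D c1 scale1r.
have trN X : \tr X - \tr ((- 1) *: X) = 2 * \tr X :> R[i].
  by rewrite mxtraceZ mulN1r opprK mulr_natl mulr2n.
rewrite D1D E1E c1 !trN.
apply: (odd_trace_neg fs V_unit gV DE) => x.
by rewrite -/(F x) DF D1D c1 scaleN1r mulmxN.
Qed.

End Odd.
End SpinTraces.

(** * The covering of the Weyl group *)

Section PinGroup.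

Variables (R : realType) (l : nat) (B : 'M[R]_l) (Cl : clifford B).
Variables (eps : {lrmorphism Cl -> Cl}) (tr : {linear Cl -> Cl}).
Hypotheses (epsP : is_grading_aut eps) (trP : is_transpose tr).
Hypotheses (Bs : forall x y, Defs.form B x y = Defs.form B y x)
  (Bp : forall x, x != 0 -> 0 < Defs.form B x x).

Lemma pin_actsE a g : in_pin eps tr a -> pin_acts eps tr a g ->
  forall x, eps a * cl_gen Cl x = cl_gen Cl (g *m x) * a.
Proof. by case=> _ ta _ ag x; rewrite -ag -mulrA ta mulr1. Qed.

Lemma in_pinM a b : in_pin eps tr a -> in_pin eps tr b -> in_pin eps tr (a * b).
Proof.
case: trP => _ trM _ [a1 a2 a3] [b1 b2 b3]; rewrite /in_pin trM; split.
- by rewrite mulrA -(mulrA a) b1 mulr1.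
- by rewrite mulrA -(mulrA (tr b)) a2 mulr1.
move=> x; have [y xy] := b3 x; have [z yz] := a3 y; exists z.
by rewrite rmorphM /= -yz -xy !mulrA.
Qed.

Lemma pin_actsM a b g h : pin_acts eps tr a g -> pin_acts eps tr b h ->
  pin_acts eps tr (a * b) (g *m h).
Proof.
case: trP => _ trM _ ag bh x.
by rewrite trM rmorphM /= -mulmxA -ag -bh !mulrA.
Qed.

Variables (Phi : root_system R l) (gT : finGroupType) (W : {group gT}).
Variable rE : mx_representation R W l.
Hypothesis (W_weyl : is_weyl_group Phi rE).
Hypothesis (B_inv : {in W, forall w x y, Defs.form B (rE w *m x) (rE w *m y) = Defs.form B x y}).

Definition root_reflection (w : gT) : Prop :=
  w \in W /\ exists2 a, a \in Defs.roots Phi & rE w = reflection Phi a.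

(** The lift is the normalized root [u] in [C(E)]: since [U * U = -1] and [eps U = tr U = - U], the
    twisted action of [U] sends [x] to [U x U], which is the reflection. *)
Lemma reflection_lift w : root_reflection w -> exists U : Cl,
  [/\ in_pin eps tr U, pin_acts eps tr U (rE w) & cl_graded true U].
Proof.
case=> Ww [a Phia wa].
have a0 : a != 0 by apply: contraNneq (roots_neq0 Phi) => <-.
have Ba := Bp a0; set b := Defs.form B a a in Ba.
have formDl x y z : Defs.form B (x + y) z = Defs.form B x z + Defs.form B y z.
  by rewrite /Defs.form raddfD /= !mulmxDl mxE.
have formZl k x z : Defs.form B (k *: x) z = k * Defs.form B x z.
  by rewrite /Defs.form linearZ /= -!scalemxAl mxE.
have formZr k x z : Defs.form B x (k *: z) = k * Defs.form B x z by rewrite Bs formZl Bs.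
have formNr x z : Defs.form B x (- z) = - Defs.form B x z.
  by rewrite -scaleN1r formZr mulN1r.
have formNl x z : Defs.form B (- x) z = - Defs.form B x z by rewrite Bs formNr Bs.
have refl x : rE w *m x = x - (coroot Phi a *m x) 0 0 *: a.
  rewrite wa /reflection mulmxBl mul1mx -mulmxA; congr (_ - _).
  by rewrite {1}[coroot Phi a *m x]mx11_scalar mul_mx_scalar.
have refla : rE w *m a = - a.
  rewrite refl (corootK Phia) mxE eqxx mulr1n -[X in X - _]scale1r -scalerBl.
  by rewrite -opprB -[2]/(1 + 1) addrK scaleN1r.
(* Invariance of [B] under the reflection forces the coroot to be the metric one. *)
have corootE x : (coroot Phi a *m x) 0 0 = 2 * Defs.form B x a / b.
  have := B_inv Ww x a; rewrite refla refl formNr formDl formNl formZl -/b.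
  set c := (_ *m _) 0 0; rewrite opprD opprK => /eqP.
  rewrite addrC subr_eq -mulr2n => /eqP cb.
  by rewrite mulr_natl -cb mulfK // lt0r_neq0.
have sb : Num.sqrt b != 0 by rewrite gt_eqF // sqrtr_gt0.
have sb2 : Num.sqrt b ^+ 2 = b by rewrite sqr_sqrtr // ltW.
pose u := (Num.sqrt b)^-1 *: a; pose U := cl_gen Cl u.
have uu : Defs.form B u u = 1.
  rewrite /u formZl formZr -/b; move: (Num.sqrt b) sb sb2 => r r0 <-.
  by rewrite expr2 mulKf // mulVf.
have UU : U * U = - 1.
  have two : 2%:R != 0 :> R by rewrite pnatr_eq0.
  apply: (scalerI two); rewrite scaler_nat mulr2n cl_genP uu mulr1.
  by rewrite scalerN scaleNr.
have epsU : eps U = - U by rewrite (epsP (cl_graded_gen Cl u)) expr1 mulN1r.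
have trU : tr U = - U by case: trP => _ _ ->.
have actU : pin_acts eps tr U (rE w).
  move=> x; rewrite epsU trU mulNr mulNr mulrN opprK.
  have := cl_genP Cl u x; rewrite -/U => /(canRL (addrK _)) ->.
  rewrite mulrBl -mulrA UU mulrN mulr1 opprK addrC mulr_algl refl linearB; congr (_ + _).
  have genZ k v : cl_gen Cl (k *: v) = k *: cl_gen Cl v by exact: linearZ_LR.
  rewrite /U /u !genZ scalerA -scaleNr; congr (_ *: _).
  rewrite corootE formZl (Bs a) mulNr; congr (- _).
  move: (Num.sqrt b) sb2 => r <-.
  by rewrite expr2 invfM [r^-1 * _]mulrC !mulrA.
exists U; split=> //; last exact: cl_graded_gen.
split; [by rewrite trU mulrN UU opprK|by rewrite trU mulNr UU opprK|].
by move=> x; exists (rE w *m x); apply: actU.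
Qed.

Variable Wt : pin_cover eps tr rE.
Local Notation G := (pc_grp Wt).
Local Notation emb := (pc_emb (p := Wt)).
Local Notation proj := (pc_proj Wt).

Lemma pc_emb_pin g : g \in G -> in_pin eps tr (emb g).
Proof.
move=> Gg; have /pc_embP[[]] // : exists2 h, h \in G & emb h = emb g by exists g.
Qed.

Lemma pc_emb_even g : ~~ odd l -> g \in G -> cl_graded false (emb g).
Proof.
move=> le Gg; have /pc_embP[_] : exists2 h, h \in G & emb h = emb g by exists g.
exact.
Qed.

Lemma pc_emb1 : emb 1%g = 1.
Proof.
have [_ t1 _] := pc_emb_pin (group1 G); have := pc_embM (group1 G) (group1 G).
rewrite mulg1 => /(congr1 (fun a => tr (emb 1%g) * a)).
by rewrite mulrA t1 mul1r.
Qed.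

Lemma pc_embV g : g \in G -> emb g * emb g^-1%g = 1.
Proof. by move=> Gg; rewrite -pc_embM ?groupV // mulgV pc_emb1. Qed.

Lemma pc_embE g : g \in G ->
  forall x, eps (emb g) * cl_gen Cl x = cl_gen Cl (rE (proj g) *m x) * emb g.
Proof. by move=> Gg; apply: pin_actsE (pc_emb_pin Gg) (pc_projP Gg). Qed.

Lemma proj_sub : (proj @* G)%g \subset W.
Proof. by apply/subsetP => _ /morphimP[g _ Gg ->]; apply: pc_projW. Qed.

(** A lift [a] of [w] is [emb g] for some [g]. Its action on [E] determines both [w] and [proj g],
    as [E] embeds in [C(E)] and [rE] is faithful. *)
Lemma mem_proj a w : w \in W -> in_pin eps tr a -> pin_acts eps tr a (rE w) ->
  (~~ odd l -> cl_graded false a) -> w \in (proj @* G)%g.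
Proof.
move=> Ww pa aw ha; have : in_Wtilde' eps tr rE a by split=> //; split=> //; exists w.
move/(pc_embP Wt) => [g Gg ga].
suff -> : w = proj g by apply: mem_morphim.
case: W_weyl => rE_faithful _ _; apply: (mx_faithful_inj rE_faithful) => //.
  exact: pc_projW.
have eq_act (x : 'cV[R]_l) : rE w *m x = rE (proj g) *m x.
  by apply: (cl_gen_inj Bp (Cl := Cl)); rewrite -aw -(pc_projP Gg) ga.
by rewrite -[rE w]mulmx1 -[RHS]mulmx1; apply/matrixP => i j;
  have := eq_act (col j 1%:M); rewrite !colE !mulmxA -!colE => /colP/(_ i); rewrite !mxE.
Qed.

Lemma proj_odd : odd l -> (proj @* G)%g = W.
Proof.
move=> l_odd; apply/eqP; rewrite eqEsubset proj_sub /=.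
case: W_weyl => _ _ {1}->; rewrite gen_subG; apply/subsetP => w.
rewrite inE => /andP[Ww /hasP[a Phia /eqP wa]].
have [|U [pU Uw _]] := @reflection_lift w; first by split=> //; exists a.
by apply: (mem_proj Ww pU Uw); rewrite l_odd.
Qed.

Lemma proj_refl2 s t : ~~ odd l -> root_reflection s -> root_reflection t ->
  (s * t)%g \in (proj @* G)%g.
Proof.
move=> le hs ht; have [U [pU Us gU]] := reflection_lift hs.
have [V [pV Vt gV]] := reflection_lift ht.
have [[Ws _] [Wt' _]] := (hs, ht).
apply: (@mem_proj (U * V)); first exact: groupM.
- exact: in_pinM.
- by rewrite repr_mxM //; apply: pin_actsM.
by move=> _; apply: (cl_gradedM gU gV).
Qed.

Lemma reflection_sqr s : root_reflection s -> (s * s = 1)%g.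
Proof.
case=> Ws [a Phia sa]; case: W_weyl => rE_faithful _ _.
apply: (mx_faithful_inj rE_faithful); rewrite ?groupM //.
rewrite repr_mxM // repr_mx1 sa /reflection mulmxBl mul1mx mulmxBr mulmx1.
rewrite -!mulmxA (mulmxA (coroot Phi a)) (corootK Phia) mul_scalar_mx -scalemxAr.
by rewrite scaler_nat mulr2n opprB addrK subrK.
Qed.

(** Products of two reflections have even lifts, so each letter of a word in reflections switches
    between the two cosets. *)
Lemma proj_even_cover s w : ~~ odd l -> root_reflection s -> w \in W ->
  (w \in (proj @* G)%g) || ((s * w)%g \in (proj @* G)%g).
Proof.
move=> le hs; case: W_weyl => _ _ {1}-> /gen_prodgP[n [c hc ->]].
elim: n c hc => [|n IH] c hc; first by rewrite big_ord0 group1.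
rewrite big_ord_recl; have hr : root_reflection (c ord0).
  have := hc ord0; rewrite inE => /andP[Wc /hasP[a Phia /eqP ca]].
  by split=> //; exists a.
case/orP: (IH (fun i => c (lift ord0 i)) (fun i => hc _)) => h.
  by rewrite mulgA (groupM (proj_refl2 le hs hr) h) orbT.
apply/orP; left; move: (\prod_(i < n) _)%g h => x h.
have -> : (c ord0 * x = (c ord0 * s) * (s * x))%g.
  by rewrite -mulgA (mulgA s) (reflection_sqr hs) mul1g.
exact: groupM (proj_refl2 le hr hs) h.
Qed.

(** All fibres of [proj] over its image have the order of the kernel, which cancels in the
    average. *)
Lemma sum_proj (F : gT -> R[i]) :
  #|G|%:R^-1 * \sum_(g in G) F (proj g) =
  #|(proj @* G)%g|%:R^-1 * \sum_(w in (proj @* G)%g) F w.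
Proof.
have -> : \sum_(g in G) F (proj g) = #|('ker proj)%g|%:R * \sum_(w in (proj @* G)%g) F w.
  rewrite (partition_big proj (mem (proj @* G)%g)) => [|g Gg] /=; last exact: mem_morphim.
  rewrite mulr_sumr; apply: eq_bigr => _ /morphimP[h _ Gh ->].
  rewrite (eq_bigr (fun=> F (proj h))) => [|g /andP[_ /eqP -> //]].
  rewrite sumr_const [RHS]mulr_natl; congr (_ *+ _).
  rewrite -(card_rcoset _ h); apply: eq_card => g; rewrite unfold_in /=.
  apply/andP/rcosetP => [[Gg /eqP e]|[k /morphpreP[Gk /set1P pk] ->]].
    exists (g * h^-1)%g; last by rewrite mulgKV.
    apply/morphpreP; split; first by rewrite groupM ?groupV.
    by apply/set1P; rewrite morphM ?groupV // morphV // e mulgV.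
  by rewrite groupM // morphM // pk mul1g.
have cG : #|G|%:R = #|('ker proj)%g|%:R * #|(proj @* G)%g|%:R :> R[i].
  by rewrite -natrM card_morphim setIid Lagrange // subsetIl.
have ker0 : #|('ker proj)%g|%:R != 0 :> R[i] by rewrite pnatr_eq0 -lt0n cardG_gt0.
by rewrite cG invfM mulrACA mulVf // mul1r.
Qed.

Variables (Sp Sm : representation R[i] G).
Hypothesis hS : spin_pair emb Sp Sm.

Definition spin_char (g : pc_gT Wt) : R[i] := \tr (Sp g) - \tr (Sm g).

Lemma spin_charV g : g \in G -> spin_char g^-1%g = ((spin_char g)^*)%C.
Proof. by move=> Gg; rewrite /spin_char !mxtrace_reprV // -rmorphB. Qed.

Lemma spin_char_norm g : g \in G ->
  spin_char g * ((spin_char g)^*)%C =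
  (\det (1%:M - rE (proj g)))%:C%C * (if odd l then 2 else 1).
Proof.
move=> Gg; rewrite -spin_charV // /spin_char.
have Gg' : g^-1%g \in G by rewrite groupV.
have aa' := pc_embV Gg; have a'a := pc_embV Gg'; rewrite invgK in a'a.
have [V [d [V_unit gV] _]] := repr_diag (map_repr (real_complex R) rE) (pc_projW Gg).
have [P P_unit PB] := form_orthonormal_basis Bs Bp.
move: hS; rewrite /spin_pair; case: ifPn => l_odd.
  case=> fp [fm [fps fms fpm SpE SmE]]; rewrite !SpE // !SmE //.
  exact: (odd_spin_trace l_odd P_unit PB fps fms fpm epsP V_unit gV aa' a'a (pc_embE Gg)).
case=> f [fp [fm [Q [fs [Q_unit fQ] [fps fms] SpE SmE]]]].
rewrite !SpE // !SmE // mulr1.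
apply: (even_spin_trace Bs Bp (proj1 fps) (proj1 fms) fs Q_unit fQ V_unit gV) => //.
- exact: pc_emb_even.
- exact: pc_emb_even.
by move=> x; have := pc_embE Gg x; rewrite (epsP (pc_emb_even l_odd Gg)) expr0 mul1r.
Qed.

(* An even lift b of a reflection and its lift U by a unit vector would make
   b^-1 U an odd element anticommuting with E. *)
Lemma proj_even : ~~ odd l ->
  #|W| = (2 * #|(proj @* G)%g|)%N /\
  {in W, forall w, w \notin (proj @* G)%g -> (\det (1%:M - rE w))%:C%C = 0 :> R[i]}.
Proof.
move=> l_even; move: hS; rewrite /spin_pair (negPf l_even).
case=> f [fp [fm [Q [fs [Q_unit fQ] [[n1 _] [n2 _]] _ _]]]].
(* Two nonzero half-spin modules give [2 ^ l = (n1 + n2) ^ 2 >= 4]; so [E] is nonzero and a root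
   exists. *)
have l_gt0 : (0 < l)%N.
  have N1 := parity_dim Bs Bp n1 n2 fs Q_unit fQ.
  rewrite lt0n; apply/negP => /eqP l0; have e1 : (2 ^ l = 1)%N by rewrite l0.
  have n12 := leq_add n1 n2.
  by have := leq_mul n12 n12; rewrite N1 e1.
have [a Phia] : exists a, a \in Defs.roots Phi.
  case E : (Defs.roots Phi) => [|a r]; last by exists a; rewrite mem_head.
  have := roots_span Phi; rewrite E span_nil => /(congr1 (@dimv _ _)).
  by rewrite dimv0 dimvf /dim /= muln1 => l0; move: l_gt0; rewrite -l0.
have [s Ws sa] : exists2 s, s \in W & rE s = reflection Phi a.
  by case: W_weyl => _ + _; apply.
have hs : root_reflection s by split=> //; exists a.
have [U [pU Us gU]] := reflection_lift hs.
have UE x : U * cl_gen Cl x = - (cl_gen Cl (rE s *m x) * U).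
  have := pin_actsE pU Us x; rewrite (epsP gU) expr1 mulN1r mulNr.
  by move/(canRL (@opprK _)).
have [UtU tUU _] := pU.
have s_notin : s \notin (proj @* G)%g.
  apply/negP => /morphimP[g _ Gg sg].
  have [bt tb _] := pc_emb_pin Gg; have gb := pc_emb_even l_even Gg.
  have bE x : emb g * cl_gen Cl x = cl_gen Cl (rE s *m x) * emb g.
    by have := pc_embE Gg x; rewrite (epsP gb) expr0 mul1r -sg.
  have gb' := pc_emb_even l_even (groupVr Gg).
  have [b'b bb'] : emb g^-1%g * emb g = 1 /\ emb g * emb g^-1%g = 1.
    by split; [have := pc_embV (groupVr Gg); rewrite invgK|exact: pc_embV].
  have yy' : emb g^-1%g * U * (tr U * emb g) = 1.
    by rewrite mulrA -(mulrA _ U) UtU mulr1.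
  have := no_odd_twisted_central Bp n1 n2 fs Q_unit fQ epsP (cl_gradedM gb' gU) yy'.
  case=> x; rewrite -mulrA UE mulrN; congr (- _).
  rewrite [RHS]mulrA [in LHS]mulrA; congr (_ * U).
  by rewrite -[LHS]mulr1 -bb' -!mulrA (mulrA _ (emb g)) -bE !mulrA b'b mul1r.
have W_cover : W :=: (proj @* G)%g :|: (s *: (proj @* G)%g)%g.
  apply/setP => w; rewrite inE; apply/idP/orP => [Ww|[]].
  - case/orP: (proj_even_cover l_even hs Ww) => h; [by left|right].
    by apply/lcosetP; exists (s * w)%g => //; rewrite mulgA reflection_sqr ?mul1g.
  - exact: (subsetP proj_sub).
  by case/lcosetP=> h /(subsetP proj_sub) Wh ->; rewrite groupM.
split.
  rewrite {1}W_cover cardsU card_lcoset (_ : _ :&: _ = set0) ?cards0 ?subn0 ?mul2n ?addnn //.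
  apply/setP => w; rewrite !inE; apply/andP => -[h1 /lcosetP[h2 Hh2 e]].
  by case/negP: s_notin; rewrite -(mulgK h2 s) -e groupM ?groupV.
move=> w Ww w_notin; have : (s * w)%g \in (proj @* G)%g.
  by case/orP: (proj_even_cover l_even hs Ww) => //; rewrite (negPf w_notin).
case/morphimP=> g _ Gg swg.
have [V [d [V_unit gV] _]] := repr_diag (map_repr (real_complex R) rE) Ww.
have gb := pc_emb_even l_even Gg.
have rEw : rE w = rE s *m rE (proj g).
  by rewrite -swg -repr_mxM // ?groupM // mulgA reflection_sqr ?mul1g.
(* [w] is [s] times the image of [g], so [U * emb g] is an odd lift of [w] and anticommutes with the
   parity operator. *)
apply: (@odd_element_trace _ _ _ _ Bs Bp _ _ f fp fm Q n1 n2 fs Q_unit fQ (rE w) V d V_unit gV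
  (U * emb g) (emb g^-1%g * tr U)).
- by rewrite mulrA -(mulrA U) pc_embV // mulr1.
- move=> x; have := pc_embE Gg x; rewrite (epsP gb) expr0 mul1r => bE.
  by rewrite -mulrA bE mulrA UE mulNr -mulrA mulmxA -rEw.
exact: (parity_mx_odd Bp n1 n2 fs Q_unit fQ epsP (cl_gradedM gU gb)).
Qed.

Lemma spin_sum (F : gT -> R[i]) :
  #|G|%:R^-1 * \sum_(g in G) F (proj g) * (spin_char g * ((spin_char g)^*)%C) =
  2 * (#|W|%:R^-1 * \sum_(w in W) F w * (\det (1%:M - rE w))%:C%C).
Proof.
pose c : R[i] := if odd l then 2 else 1.
pose D w : R[i] := F w * (\det (1%:M - rE w))%:C%C.
transitivity (#|G|%:R^-1 * \sum_(g in G) c * D (proj g)).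
  congr (_ * _); apply: eq_bigr => g Gg; rewrite spin_char_norm // -/c /D.
  by rewrite [RHS]mulrC mulrA.
rewrite (sum_proj (fun w => c * D w)) -mulr_sumr mulrCA /c.
case: ifPn => l_odd; first by rewrite proj_odd.
have [cW D0] := proj_even l_odd.
rewrite mul1r cW natrM invfM !mulrA mulfV ?pnatr_eq0 // mul1r; congr (_ * _).
rewrite [RHS](big_setID (proj @* G)%g) /= (setIidPr proj_sub).
rewrite [X in _ = _ + X]big1 ?addr0 // => w; rewrite inE => /andP[w_notin Ww].
by rewrite D0 // mulr0.
Qed.

End PinGroup.

(** * Elliptic fake degrees *)

Section VirtualCharacters.

Variables (C : fieldType) (gT : finGroupType) (G : {group gT}).

Lemma veq_vchar (V V' : vrep C G) : veq V V' -> {in G, vchar V =1 vchar V'}.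
Proof.
case=> U /mxtrace_rsim trU g Gg; have := trU g Gg.
rewrite /= !mxtrace_block => /addIr; rewrite /vchar => e.
by apply/eqP; rewrite subr_eq addrAC eq_sym subr_eq -e.
Qed.

Lemma vchar_vtensor (V V' : vrep C G) g :
  vchar (vtensor V V') g = vchar V g * vchar V' g.
Proof.
rewrite /vchar /= !mxtrace_block !mxtrace_prod mulrBl !mulrBr opprB opprD addrACA.
by rewrite -!addrA; congr (_ + _); rewrite addrCA addrC -!addrA; congr (_ + _); rewrite addrC.
Qed.

Lemma vchar_vsub (V V' : vrep C G) g : vchar (vsub V V') g = vchar V g - vchar V' g.
Proof. by rewrite /vchar /= !mxtrace_block opprD opprB addrACA. Qed.

Lemma vchar_vrep_of (U : representation C G) g : vchar (vrep_of U) g = \tr (U g).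
Proof. by rewrite /vchar /= mxtrace1 subr0. Qed.

End VirtualCharacters.

Lemma sym_mx_map (F K : fieldType) (phi : {rmorphism F -> K}) l d (M : 'M[F]_l) :
  sym_mx d (map_mx phi M) = map_mx phi (sym_mx d M).
Proof.
apply/matrixP => i j; rewrite !mxE -mcoeff_map_mpoly !lin_substX rmorph_prod.
congr (_@__); apply: eq_bigr => a _; rewrite rmorphXn; congr (_ ^+ _).
rewrite rmorph_sum; apply: eq_bigr => b _.
by rewrite /= map_mpolyZ map_mpolyX mxE.
Qed.

Section Corollary.

Variables (R : realType) (l : nat) (gT : finGroupType) (W : {group gT}).
Variable rE : mx_representation R W l.

(** Reconciles [char_pairing], which conjugates its second argument, with [ell_pairing], which does
    not. *)
Lemma mxtrace_sym_real d w : ((\tr (sym_rep rE d w))^*)%C = \tr (sym_rep rE d w).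
Proof.
have -> : \tr (sym_rep rE d w) = (\tr (sym_mx d (rE w)))%:C%C.
  transitivity (\tr (sym_mx d (map_mx (real_complex R) (rE w)))); first by [].
  by rewrite sym_mx_map trace_map_mx.
by rewrite conjc_real.
Qed.

(** Molien's formula is applied to each [w]. The 2 put into the series anticipates the ratio of the
    two pairings and is cancelled by [2^-1]. *)
Lemma fake_degree_expansion (pi : vrep R[i] W) :
  exists2 P : {fraction {poly R[i]}},
    has_expansion P (fun d => 2 * ell_pairing rE pi (vrep_of (sym_rep rE d)))
  & fake_degree rE pi = 2^-1 * (qvar R[i] - 1) ^+ l * P.
Proof.
pose D w := \det (1%:M - qvar _ *: map_mx (fun x : R => qcst x%:C%C) (rE w)).
pose c w := vchar pi w * (\det (1%:M - rE w))%:C%C.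
pose S := \sum_(w in W) qcst (c w) * (D w)^-1.
exists (qcst (2 / #|W|%:R) * S).
  apply: eq_has_expansion (has_expansionZ _ (s := fun d =>
    \sum_(w <- enum W) c w * \tr (sym_rep rE d w)) _) => [d|].
    rewrite /ell_pairing -mulrA; congr (_ * (_ * _)); rewrite big_enum.
    apply: eq_bigr => w _; by rewrite vchar_vrep_of /c mulrAC.
  rewrite /S -big_enum; apply: has_expansion_sum => w; rewrite mem_enum => Ww.
  apply: has_expansionZ.
  have [V [d [V_unit wV] _]] := repr_diag (map_repr (real_complex R) rE) Ww.
  have -> : D w = \det (1%:M - qvar R[i] *: map_mx (@qcst R[i])
      (map_repr (real_complex R) rE w)).
    rewrite /D; have -> : map_mx (fun x : R => qcst x%:C%C) (rE w) =
        map_mx (@qcst R[i]) (map_repr (real_complex R) rE w).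
      by apply/matrixP => i j; rewrite !mxE.
    reflexivity.
  exact: det_expansion V_unit wV.
have qcstM (a b : R[i]) : qcst (a * b) = qcst a * qcst b.
  by rewrite /qcst polyCM tofracM.
rewrite /fake_degree.
have -> : \sum_(w in W) qcst (vchar pi w) * qcst (\det (1%:M - rE w))%:C%C / D w = S.
  by apply: eq_bigr => w _; rewrite /c qcstM.
have qcst_nat k : qcst (k%:R : R[i]) = k%:R by rewrite /qcst !rmorph_nat.
have two : 2 != 0 :> {fraction {poly R[i]}}.
  by rewrite -(qcst_nat 2) tofrac_eq0 polyC_eq0 pnatr_eq0.
have W0 : #|W|%:R != 0 :> {fraction {poly R[i]}}.
  by rewrite -qcst_nat tofrac_eq0 polyC_eq0 pnatr_eq0 -lt0n cardG_gt0.
have -> : qcst (2 / #|W|%:R : R[i]) = 2 / #|W|%:R.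
  apply: (mulIf W0); rewrite mulfVK // -qcst_nat -qcstM mulfVK ?qcst_nat //.
  by rewrite pnatr_eq0 -lt0n cardG_gt0.
by rewrite [2^-1 * _]mulrC -[RHS]mulrA (mulrA 2^-1) (mulKf two) mulrA.
Qed.

End Corollary.

Theorem corollary2p8 (R : realType) (l : nat) (Phi : root_system R l)
    (gT : finGroupType) (W : {group gT}) (rE : mx_representation R W l)
    (hW : is_weyl_group Phi rE)
    (B : 'M[R]_l) (hB : invariant_inner_product rE B)
    (Cl : clifford B)
    (eps : {lrmorphism Cl -> Cl}) (heps : is_grading_aut eps)
    (tr : {linear Cl -> Cl}) (htr : is_transpose tr)
    (Wt : pin_cover eps tr rE)
    (Sp Sm : representation R[i] (pc_grp Wt))
    (hS : spin_pair (pc_emb (p := Wt)) Sp Sm)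
    (pi pi' : vrep R[i] W) (hpi : ell_eq rE pi pi')
    (sp sm : representation R[i] (pc_grp Wt))
    (hs : veq (vtensor (pull_vrep (pc_projW (p := Wt)) pi') (Sp, Sm)) (sp, sm))
    (hortho : no_common_constituent sp sm) :
  exists2 P : {fraction {poly R[i]}},
    has_expansion P (fun d =>
      char_pairing (sp, sm)
        (vtensor (vrep_of (pull_rep (pc_projW (p := Wt)) (sym_rep rE d)))
                 (Sp, Sm)))
  & fake_degree rE pi = 2^-1 * (qvar R[i] - 1) ^+ l * P.
Proof.
have [P Pexp FE] := fake_degree_expansion rE pi; exists P => //.
apply: eq_has_expansion Pexp => d; case: hB => Bs Bp B_inv.
pose F w := vchar pi' w * \tr (sym_rep rE d w).
(* [sp] and [sm] come from the representative [pi'] of the class of [pi]; the elliptic pairing sees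
   only the class. *)
have hPi : ell_pairing rE pi (vrep_of (sym_rep rE d)) =
    ell_pairing rE pi' (vrep_of (sym_rep rE d)).
  apply/eqP; rewrite -subr_eq0 -(hpi (vrep_of (sym_rep rE d))) /ell_pairing -mulrBr.
  rewrite -sumrB; apply/eqP; congr (_ * _); apply: eq_bigr => w _.
  by rewrite vchar_vsub !mulrBl.
transitivity (2 * (#|W|%:R^-1 * \sum_(w in W) F w * (\det (1%:M - rE w))%:C%C)).
  rewrite hPi; congr (_ * (_ * _)); apply: eq_bigr => w _.
  by rewrite vchar_vrep_of.
(* Both arguments of the pairing contain the spin difference, so its squared norm splits off and
   leaves the class function [F] pulled back from [W]. *)
rewrite -(spin_sum heps htr Bs Bp hW B_inv hS); congr (_ * _); apply: eq_bigr => g Gg.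
rewrite -(veq_vchar hs Gg) !vchar_vtensor vchar_vrep_of rmorphM /=.
by rewrite mxtrace_sym_real mulrACA.
Qed.
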